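(* Let $d\in\mathbb{N}$. For all $\alpha\in(d,d+1)$ and all integers $k\ge d+2$ and $r\ge1$, $$\lim_{N\to\infty}\frac1N\#\{n\in[1,N]\cap\mathbb{Z} : (\lfloor (n+rj)^\alpha\rfloor)_{j=0}^{k-1}\in\mathcal{P}_{k,d}\}=\mu(\mathcal{C}_{k,d+1}),$$ where $\mu$ denotes the Lebesgue measure on $\mathbb{R}^{d+1}$ and the convex set $\mathcal{C}_{k,d+1}\subset\mathbb{R}^{d+1}$ is $$\mathcal{C}_{k,d+1}=\Bigl\{(y_i)_{i=0}^d\in\mathbb{R}^{d+1} : 0\le y_0<1,\ 0\le\sum_{i=0}^d\binom{j}{i}y_i<1\ \text{ for all integers } 1\le j<k\Bigr\}.$$ Also, $\mu(\mathcal{C}_{k,d+1})\ge 1/\prod_{i=1}^d\binom{k-1}{i}$.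
   Context: $\mathbb{N}=\{1,2,\ldots\}$; $\lfloor x\rfloor$ is the greatest integer $\le x$. For integers $d\ge1$ and $k\ge d+2$, $\mathcal{P}_{k,d}$ is the set of all strictly increasing sequences $(a(n))_{n=0}^{k-1}$ of elements of $\mathbb{N}$ such that $(\Delta_1^d a(n))_{n=0}^{k-d-1}$ is a constant sequence, where $\Delta_r a(n)=a(n+r)-a(n)$ and $\Delta_r^m=\Delta_r\circ\Delta_r^{m-1}$ for $m\ge2$ (with $\Delta_r^1=\Delta_r$). Equivalently, $a(n)=p(n)$ for $0\le n<k$ for some polynomial $p\in\mathbb{Q}[x]$ of degree at most $d$. The binomial coefficient $\binom{n}{l}$ is $0$ if $0\le n<l$. *)

(* Defs.v *)
From HB Require Import structures.
From mathcomp Require Import all_boot all_order all_algebra.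
From mathcomp Require Import all_classical all_reals all_analysis.

Set Implicit Arguments.
Unset Strict Implicit.
Unset Printing Implicit Defensive.

Import Order.TTheory GRing.Theory Num.Theory.
Import numFieldNormedType.Exports.

Local Open Scope classical_set_scope.
Local Open Scope ring_scope.

Section prod_lebesgue.
Context {R : realType} (n : nat).
Local Open Scope ereal_scope.

Definition tuple_cons (p : R * n.-tuple R) : n.+1.-tuple R :=
  [tuple of p.1 :: p.2].

Definition tuple_uncons (t : n.+1.-tuple R) : R * n.-tuple R :=
  (thead t, [tuple of behead t]).

Lemma tuple_consK : cancel tuple_cons tuple_uncons.
Proof. by move=> [x t]; congr pair; rewrite ?theadE//; exact/val_inj. Qed.

Lemma tuple_unconsK : cancel tuple_uncons tuple_cons.
Proof. by move=> t; rewrite [RHS]tuple_eta; exact/val_inj. Qed.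

Lemma measurable_tuple_cons : measurable_fun [set: R * n.-tuple R] tuple_cons.
Proof. exact: measurable_cons. Qed.

Lemma measurable_tuple_uncons :
  measurable_fun [set: n.+1.-tuple R] tuple_uncons.
Proof.
apply: measurable_fun_pair; first exact: (measurable_tnth ord0).
exact: measurable_behead.
Qed.

Variable mu : {sigma_finite_measure set (n.-tuple R) -> \bar R}%R.

Definition prod_lebesgue : set (n.+1.-tuple R) -> \bar R :=
  pushforward (lebesgue_measure \x mu) tuple_cons.

Let prod_lebesgue0 : prod_lebesgue set0 = 0.
Proof. by rewrite /prod_lebesgue /pushforward preimage_set0 measure0. Qed.

Let prod_lebesgue_ge0 A : 0 <= prod_lebesgue A.
Proof. exact: (@measure_ge0 _ _ _ (lebesgue_measure \x mu)). Qed.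

Let prod_lebesgue_sigma_additive : semi_sigma_additive prod_lebesgue.
Proof.
exact: (@measure_semi_sigma_additive _ _ _
  (measure_function_pushforward__canonical__measure_function_Measure
    (lebesgue_measure \x mu) measurable_tuple_cons)).
Qed.

HB.instance Definition _ := isMeasure.Build _ _ _ prod_lebesgue
  prod_lebesgue0 prod_lebesgue_ge0 prod_lebesgue_sigma_additive.

Let prod_lebesgue_sigma_finite : sigma_finite setT prod_lebesgue.
Proof.
have /sigma_finiteP[F [TF ndF Foo]] := sigma_finiteT (@lebesgue_measure R).
have /sigma_finiteP[G [TG ndG Goo]] := sigma_finiteT mu.
exists (fun k => tuple_uncons @^-1` (F k `*` G k)).
  rewrite -preimage_bigcup (_ : \bigcup_k _ = setT)//.
  rewrite -setXTT TF TG predeqE => -[x y]; split.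
    by move=> [k _ []/= ? ?]; split; exists k.
  move=> [/= [k _ Fkx] [l _ Gly]]; exists (maxn k l) => //; split.
  - by move: x Fkx; exact/subsetPset/ndF/leq_maxl.
  - by move: y Gly; exact/subsetPset/ndG/leq_maxr.
move=> k; have [? ?] := Foo k; have [? ?] := Goo k; split.
  rewrite -[X in measurable X]setTI; apply: measurable_tuple_uncons => //.
  exact: measurableX.
rewrite /prod_lebesgue /pushforward -comp_preimage (_ : _ \o _ = id); last first.
  by apply/funext => x /=; rewrite tuple_consK.
by rewrite preimage_id product_measure1E// lte_mul_pinfty// ge0_fin_numE.
Qed.

HB.instance Definition _ := Measure_isSigmaFinite.Build _ _ _ prod_lebesgue
  prod_lebesgue_sigma_finite.

End prod_lebesgue.

(* Lebesgue measure on (the Borel sets of) R^n: the point mass on R^0, then the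
   product with Lebesgue measure on R, transported along R * R^n ~ R^(n+1).
   [lebesgue_tuple_box] gives its value on boxes, which characterizes it. *)
Fixpoint lebesgue_tuple {R : realType} (n : nat) :
    {sigma_finite_measure set (n.-tuple R) -> \bar R} :=
  match n with
  | 0 => dirac [tuple]
  | m.+1 => prod_lebesgue (lebesgue_tuple m)
  end.

Lemma measurable_tuple_box (R : realType) n (A : 'I_n -> set R) :
  (forall i, measurable (A i)) ->
  measurable [set t : n.-tuple R | forall i, A i (tnth t i)].
Proof.
move=> mA; rewrite (_ : [set _ | _] =
    \bigcap_(i in [set: 'I_n]) ((@tnth n R ^~ i) @^-1` A i)).
  apply: fin_bigcap_measurable => [|i _]; first exact: finite_finset.
  by rewrite -[X in measurable X]setTI; exact: measurable_tnth.
by apply/seteqP; split=> t /= h i => [_|]; exact: h.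
Qed.

Lemma lebesgue_tuple_box (R : realType) n (A : 'I_n -> set R) :
  (forall i, measurable (A i)) ->
  (lebesgue_tuple n [set t : n.-tuple R | forall i, A i (tnth t i)] =
   \prod_(i < n) lebesgue_measure (A i))%E.
Proof.
elim: n A => [|n IH] A mA.
  by rewrite big_ord0 /= diracE mem_set// => -[].
rewrite big_ord_recl /= /prod_lebesgue /pushforward.
rewrite (_ : _ @^-1` _ = A ord0 `*`
    [set t : n.-tuple R | forall i, A (lift ord0 i) (tnth t i)]).
  rewrite product_measure1E; [|exact: mA|].
    by congr (_ * _)%E; exact: (IH (A \o lift ord0) (fun i => mA _)).
  exact: (@measurable_tuple_box R n (A \o lift ord0) (fun i => mA _)).
apply/seteqP; split=> [[x t] /= h|[x t] /= [Ax At] i].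
- split=> [|i /=]; first exact: (h ord0).
  by move: (h (lift ord0 i)); rewrite tnthS.
- by case: (unliftP ord0 i) => [j|] ->; rewrite ?tnthS.
Qed.

Definition Delta (r : nat) (a : nat -> int) (n : nat) : int :=
  a (n + r)%N - a n.

(* Finite sequences are padded with 0 so that differences can be iterated; for
   n < k - d only entries with index < k are involved. *)
Definition poly_seqs (k d : nat) : set (k.-tuple int) :=
  [set a | [/\ forall j, 0 < tnth a j,
               forall i j : 'I_k, (i < j)%N -> tnth a i < tnth a j &
               exists c : int, forall n, (n < k - d)%N ->
                 iter d (Delta 1) (nth 0 a) n = c]].

(* C_{k,d+1}: its dimension is d+1 when the degree parameter is d. *)
Definition poly_region (R : realType) (k d : nat) : set (d.+1.-tuple R) :=
  [set y | 0 <= tnth y ord0 < 1 /\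
           forall j, (1 <= j < k)%N ->
             0 <= \sum_(i < d.+1) 'C(j, i)%:R * tnth y i < 1].

Arguments poly_seqs : clear implicits.
Arguments poly_region : clear implicits.

(* Main.v *)
Require Import Defs.
From mathcomp Require Import all_boot all_order all_algebra.
From mathcomp Require Import all_classical all_reals all_analysis.
From mathcomp Require Import measurable_realfun zify ring lra.

Set Implicit Arguments.
Unset Strict Implicit.
Unset Printing Implicit Defensive.

Import Order.TTheory GRing.Theory Num.Theory.
Import numFieldNormedType.Exports.

Local Open Scope classical_set_scope.
Local Open Scope ring_scope.

(** Put [f x = x `^ alpha] and, for fixed [n], [y j = f (n + r j)].  Since
    [alpha < d + 1], the differences of [f] of order above [d] tend to [0], so by
    Newton's formula [y j] is, up to [o(1)], the value at [j] of the polynomial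
    of degree at most [d] through [y 0, ..., y d]
    ([extrapolate_power_orbit_near]).  As [alpha > 1], the floors of the [y j]
    are positive and strictly increasing, so they belong to P_{k,d} exactly when
    they too are extrapolated from their first [d + 1] terms
    ([floor_power_orbit_poly]).  Subtracting the two extrapolations, the event
    says, up to [o(1)], that the polynomial of degree at most [d] through the
    fractional parts of [y 0, ..., y d] takes values in [0, 1) at all [j < k].
    In the binomial basis, a unimodular change of coordinates, the polynomials
    with this property form C_{k,d+1}.

    The vector [(y 0, ..., y d)] is equidistributed modulo [1] by Weyl's
    criterion.  An integer combination of its coordinates is [h(S) f] at [n] for
    a polynomial [h] in the shift [S] by [r].  If [h] vanishes at [1] to the
    order [d] exactly, then [h(S) f] is, up to [o(1)], a multiple of the [d]-th
    difference of [f], which grows like [n `^ (alpha - d)], and the theorem of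
    Fejer applies ([fejer]).  If the order is smaller, van der Corput's
    inequality ([van_der_corput]) replaces [h] by [(X^m - 1) h], whose order is
    larger by one.  A nonzero [h] of degree at most [d] has order at most [d], so
    this covers all the sums that occur ([weyl_sum]).

    To pass from exponential sums to a volume, cut the torus into cells of side
    [1 / Q].  Products of Fejer kernels attached to the cells are nonnegative,
    add up to [1] ([sum_bump]), are small away from their cell ([sum_bump_far]),
    and all have mean [Q ^- (d + 1)] ([kernel_mean]).  Hence the density lies
    between the numbers of integer-valued polynomials [p] of degree at most [d]
    with [a <= p j < b] for all [j < k], for two ranges whose length [b - a] is
    close to [Q], normalized by [Q ^- (d + 1)] ([mean_hit_bounds]).  Adding a
    constant to [p] shows that these numbers depend on [b - a] only, and the same
    numbers bound the volume from both sides ([volume_ge_lattice],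
    [volume_le_lattice]).  So no estimate of the boundary
    of the region is needed: the density and the volume agree up to the factor
    [(b - a) / Q] to the power [d + 1], which tends to [1].

    For the lower bound, write [p j = sum_i w_i z_i] with [z_i = C(k - 1, i) y_i]
    and [w_i = C(j, i) / C(k - 1, i)].  The weights decrease from [w_0 = 1], so by
    Abel summation [p j] is a convex combination of the partial sums of the
    [z_i].  Thus C_{k,d+1} contains the set where all these partial sums
    lie in [0, 1), and the volume of that set is computed one coordinate at a
    time ([lebesgue_partial_sums]). *)

(** * Finite differences and extrapolation *)

Definition fdiff (V : zmodType) (g : nat -> V) (n : nat) : V := g n.+1 - g n.

(** The polynomial whose coordinates in the basis of binomial polynomials are the
    first [D] terms of [q], evaluated at [j].  The sum makes sense in any abelian
    group, so it serves for floors as well as for reals. *)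
Definition newton (V : zmodType) (D : nat) (q : nat -> V) (j : nat) : V :=
  \sum_(i < D) q i *+ 'C(j, i).

(** Newton's form of the polynomial of degree below [D] that agrees with [g] at
    [0, ..., D - 1]; see [extrapolate_low]. *)
Definition extrapolate (V : zmodType) (D : nat) (g : nat -> V) : nat -> V :=
  newton D (fun i => iter i (@fdiff V) g 0%N).

Lemma newton_recl (V : zmodType) D (q : nat -> V) j :
  newton D.+1 q j.+1 = newton D.+1 q j + newton D (fun i => q i.+1) j.
Proof.
rewrite /newton big_ord_recl bin0 [in RHS]big_ord_recl bin0 -addrA; congr (_ + _).
by rewrite -big_split; apply: eq_bigr => i _; rewrite /= /bump add1n binS mulrnDr.
Qed.

Lemma newton_high (V : zmodType) D (q : nat -> V) j :
  (j < D)%N -> newton D q j = newton j.+1 q j.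
Proof.
move=> jD; rewrite /newton -!(big_mkord xpredT (fun i => q i *+ 'C(j, i))).
rewrite (big_cat_nat (leq0n j.+1) jD) /= [X in _ + X](_ : _ = 0) ?addr0 //.
by rewrite big_nat_cond big1 // => i /andP[/andP[ji _] _]; rewrite bin_small.
Qed.

(** Induction on [j] along [g j.+1 = g j + fdiff g j], which is Pascal's rule on the
    side of the coefficients. *)
Lemma newton_expansion (V : zmodType) (g : nat -> V) j :
  g j = newton j.+1 (fun i => iter i (@fdiff V) g 0%N) j.
Proof.
elim: j g => [|j IH] g.
  by rewrite /newton big_ord_recl big_ord0 addr0 /= mulr1n.
rewrite newton_recl newton_high // -IH.
under [X in newton _ X j]boolp.eq_fun do rewrite iterSr.
by rewrite -IH /fdiff addrC subrK.
Qed.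

Lemma fdiff_newton (V : zmodType) D (q : nat -> V) :
  fdiff (newton D.+1 q) = newton D (fun i => q i.+1).
Proof. by apply/funext => j; rewrite /fdiff newton_recl addrC addKr. Qed.

(** A difference lowers binomial polynomials by one degree, hence shifts the
    coefficients. *)
Lemma iter_fdiff_newton (V : zmodType) D (q : nat -> V) i n :
  (i <= D)%N -> iter i (@fdiff V) (newton D q) n =
                newton (D - i) (fun l => q (i + l)%N) n.
Proof.
elim: i D q n => [|i IH] [|D] q n // iD.
by rewrite iterSr fdiff_newton IH // subSS.
Qed.

Lemma newton0 (V : zmodType) D (q : nat -> V) : newton D.+1 q 0 = q 0%N.
Proof.
by rewrite newton_high // /newton big_ord_recl big_ord0 addr0 mulr1n.
Qed.

Lemma iter_fdiff_newton0 (V : zmodType) D (q : nat -> V) i :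
  (i < D)%N -> iter i (@fdiff V) (newton D q) 0%N = q i.
Proof.
move=> iD; rewrite iter_fdiff_newton; last exact: ltnW.
by rewrite -[(D - i)%N]prednK ?subn_gt0 // newton0 addn0.
Qed.

Lemma eq_iter_fdiff (V : zmodType) (g h : nat -> V) i n :
  (forall l, (l <= n + i)%N -> g l = h l) ->
  iter i (@fdiff V) g n = iter i (@fdiff V) h n.
Proof.
elim: i n => [|i IH] n gh /=; first by rewrite gh ?addn0.
by rewrite /fdiff !IH // => l ln; apply: gh; lia.
Qed.

Lemma eq_newton (V : zmodType) D (p q : nat -> V) j :
  (forall i, (i < D)%N -> p i = q i) -> newton D p j = newton D q j.
Proof. by move=> pq; apply: eq_bigr => i _; rewrite pq. Qed.

Lemma eq_extrapolate (V : zmodType) D (g h : nat -> V) j :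
  (forall i, (i < D)%N -> g i = h i) -> extrapolate D g j = extrapolate D h j.
Proof.
move=> gh; apply: eq_newton => i iD; apply: eq_iter_fdiff => l.
by rewrite add0n => li; apply: gh; lia.
Qed.

Lemma extrapolate_low (V : zmodType) D (g : nat -> V) j :
  (j < D)%N -> extrapolate D g j = g j.
Proof. by move=> jD; rewrite /extrapolate newton_high // -newton_expansion. Qed.

Lemma extrapolate_newton (V : zmodType) D (q : nat -> V) j :
  extrapolate D (newton D q) j = newton D q j.
Proof. by apply: eq_newton => i iD; rewrite iter_fdiff_newton0. Qed.

(** The full expansion [newton_expansion] without the orders that extrapolation
    keeps.  This is how small or vanishing high differences enter. *)
Lemma extrapolate_error (V : zmodType) D (g : nat -> V) j :
  g j - extrapolate D g j =
  \sum_(D <= i < j.+1) iter i (@fdiff V) g 0%N *+ 'C(j, i).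
Proof.
have [jD|Dj] := ltnP j D.
  by rewrite extrapolate_low // subrr big_geq.
rewrite {1}(newton_expansion g j) /extrapolate /newton.
rewrite -!(big_mkord xpredT (fun i => iter i (@fdiff V) g 0%N *+ 'C(j, i))).
by rewrite (big_cat_nat (leq0n D)) /= 1?ltnW // [LHS]addrC addKr.
Qed.

Lemma iter_fdiffB (V : zmodType) (g h : nat -> V) i n :
  iter i (@fdiff V) (fun l => g l - h l) n =
  iter i (@fdiff V) g n - iter i (@fdiff V) h n.
Proof.
elim: i n => // i IH n; rewrite /= /fdiff !IH !opprB [in RHS]addrACA.
by rewrite -!addrA; congr (_ + _); rewrite addrC -addrA.
Qed.

Lemma extrapolateB (V : zmodType) D (g h : nat -> V) j :
  extrapolate D (fun l => g l - h l) j = extrapolate D g j - extrapolate D h j.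
Proof.
rewrite /extrapolate /newton -sumrB; apply: eq_bigr => i _.
by rewrite iter_fdiffB mulrnBl.
Qed.

Lemma iter_fdiff_cst0 (V : zmodType) (c : V) i n :
  (0 < i)%N -> iter i (@fdiff V) (fun=> c) n = 0.
Proof.
case: i => // i _; rewrite iterSr (_ : fdiff _ = fun=> 0); last first.
  by apply/funext => l; exact: subrr.
by elim: i n => //= i IH n; rewrite /fdiff !IH subrr.
Qed.

Lemma extrapolate_cst (V : zmodType) D (a : V) j :
  extrapolate D.+1 (fun=> a) j = a.
Proof.
rewrite /extrapolate /newton big_ord_recl bin0 mulr1n big1 ?addr0 // => i _.
by rewrite iter_fdiff_cst0 ?mul0rn.
Qed.

Lemma extrapolate_raddf (U V : zmodType) (f : {additive U -> V}) D
    (g : nat -> U) j :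
  extrapolate D (f \o g) j = f (extrapolate D g j).
Proof.
rewrite /extrapolate /newton raddf_sum; apply: eq_bigr => i _.
rewrite raddfMn; congr (_ *+ _).
by elim: {i} (val i) 0%N => // i IH n; rewrite /= /fdiff !IH raddfB.
Qed.

Lemma iter_fdiff_norm (R : realDomainType) (g : nat -> R) e i n :
  (forall l, (l <= n + i)%N -> `|g l| <= e) ->
  `|iter i (@fdiff R) g n| <= e *+ (2 ^ i).
Proof.
elim: i n => [|i IH] n ge /=; first by rewrite expn0 mulr1n ge ?addn0.
rewrite (le_trans (ler_normB _ _)) // expnS mulnC mulrnA mulr2n.
by rewrite lerD // IH // => l ln; apply: ge; lia.
Qed.

(** An upper bound, uniform in [j < k], for the norm of [extrapolate D ^~ j] with
    respect to the supremum norm. *)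
Definition extrapolation_bound (D k : nat) : nat :=
  \sum_(j < k) \sum_(i < D) 2 ^ i * 'C(j, i).

Lemma extrapolate_norm (R : realDomainType) D k (g : nat -> R) e j :
  (j < k)%N -> 0 <= e -> (forall l, (l < D)%N -> `|g l| <= e) ->
  `|extrapolate D g j| <= e *+ extrapolation_bound D k.
Proof.
move=> jk e0 ge.
have -> : extrapolation_bound D k =
    (\sum_(i < D) 2 ^ i * 'C(j, i) +
     (extrapolation_bound D k - \sum_(i < D) 2 ^ i * 'C(j, i)))%N.
  rewrite subnKC // /extrapolation_bound (bigD1 (Ordinal jk)) //=.
  exact: leq_addr.
rewrite mulrnDr -[X in X <= _]addr0 lerD ?mulrn_wge0 //.
rewrite -sumrMnr (le_trans (ler_norm_sum _ _ _)) //; apply: ler_sum => i _.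
rewrite normrMn mulrnA lerMn2r iter_fdiff_norm ?orbT // => l.
by rewrite add0n => li; apply: ge; exact: leq_ltn_trans (ltn_ord i).
Qed.

(** * Cesaro means of oscillating sequences *)

Definition has_mean (R : realType) (a : nat -> R) (l : R) : Prop :=
  arithmetic_mean a @ \oo --> l.

Lemma arithmetic_meanE (R : realType) (a : nat -> R) N :
  arithmetic_mean a N = N.+1%:R^-1 * \sum_(n < N.+1) a n.
Proof. by rewrite /arithmetic_mean /= seriesEord. Qed.

Lemma arithmetic_mean_le (R : realType) (a b : nat -> R) N :
  (forall n, a n <= b n) -> arithmetic_mean a N <= arithmetic_mean b N.
Proof.
move=> ab; rewrite !arithmetic_meanE ler_wpM2l ?invr_ge0 //.
by apply: ler_sum => n _.
Qed.

Lemma has_meanD (R : realType) (a b : nat -> R) l m :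
  has_mean a l -> has_mean b m -> has_mean (fun n => a n + b n) (l + m).
Proof.
move=> al bm; rewrite /has_mean.
rewrite (_ : arithmetic_mean _ = arithmetic_mean a \+ arithmetic_mean b).
  exact: cvgD.
by apply/funext => N /=; rewrite !arithmetic_meanE big_split mulrDr.
Qed.

Lemma has_meanZ (R : realType) (a : nat -> R) l c :
  has_mean a l -> has_mean (fun n => c * a n) (c * l).
Proof.
move=> al; rewrite /has_mean.
rewrite (_ : arithmetic_mean _ = (fun N => c * arithmetic_mean a N)).
  exact: cvgMl_tmp.
by apply/funext => N /=; rewrite !arithmetic_meanE -mulr_sumr mulrCA.
Qed.

Lemma has_mean_cvg (R : realType) (a : nat -> R) l :
  a @ \oo --> l -> has_mean a l.
Proof. exact: cesaro. Qed.

Lemma has_mean_cst (R : realType) (c : R) : has_mean (fun=> c) c.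
Proof. by apply: has_mean_cvg; exact: cvg_cst. Qed.

Lemma has_mean_sum (R : realType) (I : Type) (r : seq I) (P : pred I)
    (a : I -> nat -> R) (l : I -> R) :
  (forall i, P i -> has_mean (a i) (l i)) ->
  has_mean (fun n => \sum_(i <- r | P i) a i n) (\sum_(i <- r | P i) l i).
Proof.
move=> al; elim: r => [|i r IH].
  rewrite big_nil (_ : (fun _ => _) = fun=> 0); first exact: has_mean_cst.
  by apply/funext => n; rewrite big_nil.
rewrite big_cons (_ : (fun _ => _) =
    fun n => if P i then a i n + \sum_(j <- r | P j) a j n
             else \sum_(j <- r | P j) a j n).
  by case: ifPn => // Pi; apply: has_meanD => //; exact: al.
by apply/funext => n; rewrite big_cons.
Qed.

Lemma has_mean_eq (R : realType) (a b : nat -> R) l :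
  a \- b @ \oo --> (0 : R) -> has_mean b l -> has_mean a l.
Proof.
move=> /has_mean_cvg /has_meanD h /h; rewrite add0r; congr (has_mean _ _).
by apply/funext => n /=; rewrite subrK.
Qed.

(** Finitely many terms do not affect a mean, so [a] may be replaced by [b] after
    a change of finitely many terms of [b]. *)
Lemma has_mean_near_le (R : realType) (a b : nat -> R) (l e : R) :
  (\forall n \near \oo, a n <= b n) -> has_mean b l -> 0 < e ->
  \forall N \near \oo, arithmetic_mean a N <= l + e.
Proof.
move=> [n0 _ ab] bl e0; pose b' n := if (n0 <= n)%N then b n else a n.
have b'l : has_mean b' l.
  apply: has_mean_eq bl; apply: (@cvg_near_cst _ _ (0 : R)).
  by exists n0 => //= n n0n; rewrite /b' n0n subrr.
move/cvgrPdist_le: b'l => /(_ _ e0); apply: filterS => N.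
rewrite ler_distlC => /andP[_]; apply: le_trans.
apply: arithmetic_mean_le => n.
by rewrite /b'; case: ifP => // /ab.
Qed.

Lemma has_mean_near_ge (R : realType) (a b : nat -> R) (l e : R) :
  (\forall n \near \oo, b n <= a n) -> has_mean b l -> 0 < e ->
  \forall N \near \oo, l - e <= arithmetic_mean a N.
Proof.
move=> ab bl e0.
have /has_mean_near_le : \forall n \near \oo, -1 * a n <= -1 * b n.
  by apply: filterS ab => n abn; rewrite !mulN1r lerN2.
move=> /(_ _ _ (has_meanZ (c := -1) bl) e0); apply: filterS => N.
have -> : arithmetic_mean (fun n => -1 * a n) N = - arithmetic_mean a N.
  by rewrite !arithmetic_meanE -mulr_sumr mulrCA mulN1r.
by rewrite lerNl => h; lra.
Qed.

(** The sum of the differences telescopes up to [2 s] bounded terms. *)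
Lemma has_mean_shiftB (R : realType) (a : nat -> R) (B : R) s :
  (forall n, `|a n| <= B) -> has_mean (fun n => a (n + s)%N - a n) 0.
Proof.
move=> aB; elim: s => [|s IH].
  rewrite (_ : (fun _ => _) = fun=> 0); first exact: has_mean_cst.
  by apply/funext => n; rewrite addn0 subrr.
have d0 : (fun N : nat => 2 * B * N.+1%:R^-1) @ \oo --> (0 : R).
  by rewrite -[X in _ --> X](mulr0 (2 * B)); apply: cvgMl_tmp; exact: cvg_harmonic.
rewrite -[0]add0r (_ : (fun _ => _) =
    fun n => (a (n + s.+1)%N - a (n + s)%N) + (a (n + s)%N - a n)); last first.
  by apply/funext => n; rewrite addrA subrK.
apply: has_meanD IH; rewrite /has_mean; apply/norm_cvg0P.
apply: (squeeze_cvgr _ (cvg_cst _) d0); apply: nearW => N.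
rewrite normr_ge0 /= arithmetic_meanE normrM mulrC.
rewrite [`|_^-1|]ger0_norm ?invr_ge0 // ler_wpM2r ?invr_ge0 //.
rewrite -(big_mkord xpredT (fun n => a (n + s.+1)%N - a (n + s)%N)).
under eq_bigr do rewrite addnS -addSn.
rewrite telescope_sumr // (le_trans (ler_normB _ _)) // mulr_natl mulr2n.
exact: lerD.
Qed.

Lemma has_mean_shift (R : realType) (a : nat -> R) (B l : R) s :
  (forall n, `|a n| <= B) -> has_mean a l -> has_mean (fun n => a (n + s)%N) l.
Proof.
move=> /(has_mean_shiftB s) /has_meanD h /h; rewrite add0r.
by congr (has_mean _ _); apply/funext => n; rewrite subrK.
Qed.

Lemma cos_lipschitz (R : realType) (x y : R) : `|cos x - cos y| <= `|x - y|.
Proof.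
wlog yx : x y / y <= x.
  move=> h; have [|/ltW] := leP y x; first exact: h.
  by rewrite distrC (distrC x); exact: h.
have [//|c _ ->] := @MVT_segment R cos (fun t => - sin t) y x yx (fun t _ => is_derive_cos t).
  apply: continuous_subspaceT => t; exact: continuous_cos.
by rewrite normrM normrN ler_piMl // sin_max.
Qed.

Lemma sin_taylor (R : realType) (x h : R) :
  `|sin (x + h) - sin x - h * cos x| <= h ^+ 2.
Proof.
have [c xc ->] : exists2 c, `|c - x| <= `|h| & sin (x + h) - sin x = cos c * h.
  have dsin (t : R) := @is_derive_sin R t.
  have csin a b : {within `[a, b]%classic, continuous (@sin R)}.
    by apply: continuous_subspaceT => t; exact: continuous_sin.
  have [h0|h0] := leP 0 h.
    have [|c] := @MVT_segment R sin cos x (x + h) _ (fun t _ => dsin t) (csin _ _).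
      by rewrite lerDl.
    rewrite in_itv /= => /andP[xc cx] E; exists c; last by rewrite E addrAC subrr add0r.
    by rewrite !ger0_norm //; lra.
  have [|c] := @MVT_segment R sin cos (x + h) x _ (fun t _ => dsin t) (csin _ _).
    by rewrite gerDl ltW.
  rewrite in_itv /= => /andP[xc cx] E; exists c; last by rewrite -[LHS]opprB E; lra.
  by rewrite distrC ger0_norm ?ltr0_norm; lra.
rewrite (mulrC h) -mulrBl normrM -[h ^+ 2]real_normK ?num_real // expr2 ler_wpM2r //.
by rewrite (le_trans (cos_lipschitz _ _)).
Qed.

Lemma has_mean_cos_eq (R : realType) (f g : nat -> R) l :
  f \- g @ \oo --> (0 : R) -> has_mean (cos \o g) l -> has_mean (cos \o f) l.
Proof.
move=> fg; apply: has_mean_eq; apply/norm_cvg0P.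
apply: (squeeze_cvgr _ (cvg_cst _)); last by apply/norm_cvg0P; exact: fg.
by apply: nearW => n; rewrite normr_ge0 /= cos_lipschitz.
Qed.

(** The variance is nonnegative. *)
Lemma sqr_arithmetic_mean (R : realType) (a : nat -> R) N :
  arithmetic_mean a N ^+ 2 <= arithmetic_mean (fun n => a n ^+ 2) N.
Proof.
set c := arithmetic_mean a N.
have : 0 <= arithmetic_mean (fun n => (a n - c) ^+ 2) N.
  by rewrite arithmetic_meanE mulr_ge0 ?invr_ge0 // sumr_ge0 // => n _; exact: sqr_ge0.
suff -> : arithmetic_mean (fun n => (a n - c) ^+ 2) N =
          arithmetic_mean (fun n => a n ^+ 2) N - c ^+ 2 by rewrite subr_ge0.
have cE : \sum_(n < N.+1) a n = N.+1%:R * c.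
  by rewrite /c arithmetic_meanE mulrA divff ?mul1r // pnatr_eq0.
rewrite !arithmetic_meanE.
under eq_bigr do rewrite sqrrB -mulrnAl.
rewrite big_split sumrB /= -mulr_suml sumr_const card_ord sumrMnl cE.
rewrite -[c ^+ 2 *+ _]mulr_natl -[_ *+ 2]mulr_natl !mulrDr.
have : (N.+1%:R : R) != 0 by rewrite pnatr_eq0.
by move: (N.+1%:R : R) => M M0; field.
Qed.

(** Up to [o(1)] the mean is unchanged if [cos (g n + theta)] is replaced by its
    average over the shifts by [r m], [m < M].  The mean of the squares of these
    averages is at most the mean of the correlations
    [cos (g (n + r m) - g (n + r l))]; for [m <> l] these have mean [0] by
    hypothesis, and the diagonal contributes [1 / M], which is arbitrarily small. *)
Lemma van_der_corput (R : realType) (g : nat -> R) (r : nat) :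
  (forall m, (0 < m)%N -> has_mean (fun n => cos (g (n + r * m)%N - g n)) 0) ->
  forall theta, has_mean (fun n => cos (g n + theta)) 0.
Proof.
move=> g0 theta.
have cos1 n : `|cos (g n + theta)| <= 1 by exact: cos_max.
apply/cvgr0Pnorm_le => e e0.
(* The diagonal adds [1 / M] to the mean square, which has to stay below
   [(e / 2) ^+ 2] with room for the passage to the limit. *)
have [M M0 Me] : exists2 M, (0 < M)%N & M%:R^-1 < (e / 2) ^+ 2 / 2.
  have i0 : 0 < (e / 2) ^+ 2 / 2 by rewrite divr_gt0 // exprn_gt0 // divr_gt0.
  exists (Num.truncn ((e / 2) ^+ 2 / 2)^-1).+1 => //.
  by rewrite invf_plt ?posrE ?ltr0n // truncnS_gt.
have Mn0 : (M%:R : R) != 0 by rewrite pnatr_eq0 -lt0n.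
pose b n := M%:R^-1 * \sum_(m < M) cos (g (n + r * m)%N + theta).
pose B n := M%:R^-2 * \sum_(m < M) \sum_(l < M) cos (g (n + r * m)%N - g (n + r * l)%N).
have bB n : b n ^+ 2 <= B n.
  have -> : B n = b n ^+ 2 + (M%:R^-1 * \sum_(m < M) sin (g (n + r * m)%N + theta)) ^+ 2.
    rewrite /b !exprMn -mulrDr exprVn; congr (_ * _).
    rewrite !expr2 !mulr_suml -big_split; apply: eq_bigr => m _ /=.
    rewrite !mulr_sumr -big_split; apply: eq_bigr => l _ /=.
    by rewrite -cosB; congr cos; ring.
  by rewrite lerDl sqr_ge0.
have meanB : has_mean B M%:R^-1.
  have -> : M%:R^-1 = M%:R^-2 * \sum_(m < M) \sum_(l < M) (m == l)%:R :> R.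
    rewrite (eq_bigr (fun=> 1)); last first.
      move=> m _; rewrite (bigD1 m) //= eqxx big1 ?addr0 // => l.
      by rewrite eq_sym => /negbTE ->.
    by rewrite sumr_const card_ord; field.
  apply: has_meanZ; apply: has_mean_sum => m _; apply: has_mean_sum => l _.
  have key (i j : nat) : (i < j)%N ->
      has_mean (fun n => cos (g (n + r * j)%N - g (n + r * i)%N)) 0.
    move=> ij; have := g0 (j - i)%N; rewrite subn_gt0 => /(_ ij).
    move=> /(@has_mean_shift R _ 1 0 (r * i) (fun _ => cos_max _)).
    congr (has_mean _ _); apply/funext => n; congr (cos (g _ - _)).
    by rewrite mulnBr; nia.
  have [-> |] := eqVneq m l.
    rewrite (_ : (fun _ => _) = fun=> 1); first exact: has_mean_cst.
    by apply/funext => n; rewrite subrr cos0.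
  rewrite neq_ltn => /orP[/key|/key] //.
  by congr (has_mean _ _); apply/funext => n; rewrite -cosN opprB.
have meanab : has_mean (fun n => cos (g n + theta) - b n) 0.
  rewrite (_ : (fun _ => _) = fun n => - M%:R^-1 *
      \sum_(m < M) (cos (g (n + r * m)%N + theta) - cos (g n + theta))).
    rewrite -[X in has_mean _ X](mulr0 (- M%:R^-1)); apply: has_meanZ.
    rewrite [X in has_mean _ X](_ : 0 = \sum_(m < M) 0); last by rewrite big1.
    apply: has_mean_sum => m _.
    exact: (has_mean_shiftB (a := fun n => cos (g n + theta)) (B := 1)).
  by apply/funext => n; rewrite sumrB sumr_const card_ord -mulr_natl /b; field.
have : 0 < (e / 2) ^+ 2 / 2 by rewrite divr_gt0 // exprn_gt0 // divr_gt0.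
move=> /(has_mean_near_le (nearW _ bB) meanB) near1.
have e20 : 0 < e / 2 by rewrite divr_gt0.
move/cvgr0Pnorm_le: meanab => /(_ _ e20) near2.
near=> N.
have h1 : arithmetic_mean b N ^+ 2 <= (e / 2) ^+ 2.
  apply: le_trans (sqr_arithmetic_mean _ _) _.
  by apply: (@le_trans _ _ (M%:R^-1 + (e / 2) ^+ 2 / 2)); [near: N|lra].
have h2 : `|arithmetic_mean (fun n => cos (g n + theta) - b n) N| <= e / 2.
  by near: N; exact: near2.
have {}h1 : `|arithmetic_mean b N| <= e / 2.
  by rewrite -(@ler_pXn2r _ 2) ?nnegrE // ?real_normK ?num_real // ltW.
have -> : arithmetic_mean (fun n => cos (g n + theta)) N =
    arithmetic_mean (fun n => cos (g n + theta) - b n) N + arithmetic_mean b N.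
  by rewrite !arithmetic_meanE -mulrDr -big_split; under [in RHS]eq_bigr do rewrite /= subrK.
by rewrite (le_trans (ler_normD _ _)) // [e]splitr lerD.
Unshelve. all: by end_near. Qed.

(** The difference between the sum and its boundary term [beta N * s N.+1] is, by
    summation by parts, at most [beta 0] plus the variation of [beta], which is
    [beta N] because [beta] is monotone. *)
Lemma abel_sum_bound (R : realType) (s beta : nat -> R) N :
  (forall n, `|s n| <= 1) -> (forall n, 0 <= beta n) ->
  (forall n, beta n <= beta n.+1) ->
  `|\sum_(n < N.+1) beta n * (s n.+1 - s n)| <= 2 * beta N.
Proof.
move=> s1 b0 bS.
have : `|\sum_(n < N.+1) beta n * (s n.+1 - s n) - beta N * s N.+1| <= beta N.
  elim: N => [|N IH].
    rewrite big_ord_recl big_ord0 addr0 mulrBr addrAC subrr add0r normrN normrM.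
    by rewrite ger0_norm // ler_piMr.
  rewrite big_ord_recr /=.
  rewrite (_ : _ - _ = (\sum_(n < N.+1) beta n * (s n.+1 - s n) - beta N * s N.+1)
      - (beta N.+1 - beta N) * s N.+1); last by ring.
  rewrite (le_trans (ler_normB _ _)) // -[leRHS](subrKC (beta N)) lerD //.
  by rewrite normrM ger0_norm ?subr_ge0 // ler_piMr ?subr_ge0.
have : `|beta N * s N.+1| <= beta N by rewrite normrM ger0_norm // ler_piMr.
rewrite !ler_norml; lra.
Qed.

(** By Taylor's formula [cos (phi n)] is the increment of [sin \o phi] divided by
    [c * delta n], up to an error [O(delta n)].  The errors have mean [0], and
    summation by parts bounds the sum of the quotients by [O(1 / delta N)],
    which is [o(N)]. *)
Lemma fejer (R : realType) (phi delta : nat -> R) (c : R) :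
  c != 0 -> (forall n, phi n.+1 - phi n = c * delta n) ->
  (forall n, 0 < delta n) -> (forall n, delta n.+1 <= delta n) ->
  delta @ \oo --> (0 : R) -> (fun n => n.+1%:R * delta n) @ \oo --> +oo ->
  has_mean (cos \o phi) 0.
Proof.
move=> c0 phiS dp dS d0 dy.
pose s n := sin (phi n).
pose main n := (delta n)^-1 * (s n.+1 - s n).
pose rest n := cos (phi n) - c^-1 * main n.
have rest0 : rest @ \oo --> (0 : R).
  apply/norm_cvg0P.
  have cd0 : (fun n => `|c| * delta n) @ \oo --> (0 : R).
    by rewrite -[X in _ --> X](mulr0 `|c|); exact: cvgMl_tmp.
  apply: (squeeze_cvgr _ (cvg_cst _) cd0); apply: nearW => n.
  rewrite normr_ge0 /=.
  have := sin_taylor (phi n) (c * delta n).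
  rewrite -phiS subrKC phiS.
  have -> : rest n = - (c * delta n)^-1 *
      (sin (phi n.+1) - sin (phi n) - c * delta n * cos (phi n)).
    rewrite /rest /main /s; field; by rewrite c0 lt0r_neq0.
  move=> h; rewrite normrM normrN normfV mulrC ler_pdivrMr; last first.
    by rewrite normr_gt0 mulf_neq0 // lt0r_neq0.
  apply: le_trans h _; rewrite -real_normK ?num_real // expr2 normrM.
  by rewrite (ger0_norm (ltW (dp n))).
rewrite -[0](add0r 0) -{2}(mulr0 c^-1).
rewrite (_ : _ \o _ = fun n => rest n + c^-1 * main n); last first.
  by apply/funext => n; rewrite /rest subrK.
apply: has_meanD (has_mean_cvg rest0) _; apply: has_meanZ.
apply/norm_cvg0P.
have l0 : (fun n => 2 * (n.+1%:R * delta n)^-1) @ \oo --> (0 : R).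
  rewrite -[X in _ --> X](mulr0 2); apply: cvgMl_tmp.
  apply/gtr0_cvgV0 => //; apply: nearW => n; exact: mulr_gt0.
apply: (squeeze_cvgr _ (cvg_cst _) l0); apply: nearW => N.
rewrite normr_ge0 /= arithmetic_meanE normrM ger0_norm ?invr_ge0 //.
rewrite invfM mulrCA ler_wpM2l ?invr_ge0 //.
apply: (abel_sum_bound N (s := s) (beta := fun n => (delta n)^-1)).
- by move=> n; exact: sin_max.
- by move=> n; rewrite invr_ge0 ltW.
- by move=> n; rewrite lef_pV2 ?posrE.
Qed.

(** * Differences of power functions *)

(** Differences with one step per order: those of the progression have step [r]
    while those of the index [n] have step [1], and both occur together. *)
Definition mdiff (R : realType) (steps : seq R) (g : R -> R) : R -> R :=
  foldr (fun s h x => h (x + s) - h x) g steps.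

Lemma mdiffZ (R : realType) (L : seq R) c (g : R -> R) x :
  mdiff L (fun y => c * g y) x = c * mdiff L g x.
Proof. by elim: L x => //= s L IH x; rewrite !IH mulrBr. Qed.

Lemma iter_fdiff_mdiff (R : realType) (g : R -> R) (x s : R) i j :
  iter i (@fdiff R) (fun l => g (x + s * l%:R)) j =
  mdiff (nseq i s) g (x + s * j%:R).
Proof.
elim: i j => //= i IH j; rewrite /fdiff !IH; congr (mdiff _ _ _ - _).
by rewrite -natr1; ring.
Qed.

Lemma is_derive_mdiff (R : realType) (L : seq R) (g g' : R -> R) :
  {in L, forall s, 0 < s} ->
  (forall x : R, 0 < x -> is_derive x 1 g (g' x)) ->
  forall x : R, 0 < x -> is_derive x 1 (mdiff L g) (mdiff L g' x).
Proof.
move=> + dg; elim: L => [_|s L IH Lp] x x0 //=; first exact: dg.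
have {}IH (y : R) : 0 < y -> is_derive y 1 (mdiff L g) (mdiff L g' y).
  by apply: IH => t tL; apply: Lp; rewrite inE tL orbT.
have s0 : 0 < s by apply: Lp; rewrite mem_head.
have ds : is_derive x 1 (fun y : R => y + s) 1.
  by rewrite -[X in is_derive _ _ _ X]addr0; apply: is_deriveD.
have d1 := @is_derive1_comp R (mdiff L g) (+%R^~ s) x _ _ (IH _ (addr_gt0 x0 s0)) ds.
by rewrite -[X in X - _]mulr1; exact: is_deriveB d1 (IH x x0).
Qed.

(** The mean value theorem, applied once for each step: differencing commutes with
    derivation, and the derivative of a power function is again one. *)
Lemma mdiff_powR (R : realType) (L : seq R) (beta x : R) :
  {in L, forall s, 0 < s} -> 0 < x ->
  exists2 xi, x <= xi <= x + \sum_(s <- L) s &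
    mdiff L (@powR R ^~ beta) x =
      (\prod_(s <- L) s) * (\prod_(i < size L) (beta - i%:R)) *
      xi `^ (beta - (size L)%:R).
Proof.
elim: L beta x => [|s L IH] beta x Lp x0.
  by exists x; rewrite ?big_nil ?big_ord0 /= ?addr0 ?lexx // subr0 !mul1r.
have s0 : 0 < s by apply: Lp; rewrite mem_head.
have {}Lp : {in L, forall s, 0 < s} by move=> t tL; apply: Lp; rewrite inE tL orbT.
have dL (y : R) : 0 < y -> is_derive y 1 (mdiff L (@powR R ^~ beta))
    (beta * mdiff L (@powR R ^~ (beta - 1)) y).
  move=> y0; rewrite -mdiffZ.
  apply: (@is_derive_mdiff R L _ (fun z => beta * z `^ (beta - 1))) => // z z0.
have xxs : x < x + s by rewrite ltrDl.
have [||c] := @MVT R (mdiff L (@powR R ^~ beta))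
  (fun y => beta * mdiff L (@powR R ^~ (beta - 1)) y) _ _ xxs.
- by move=> y; rewrite in_itv /= => /andP[xy _]; apply: dL; exact: lt_trans xy.
- apply: derivable_within_continuous => y; rewrite in_itv /= => /andP[xy _].
  by have /dL[] : 0 < y by exact: lt_le_trans xy.
rewrite in_itv /= => /andP[xc cs] ->.
have [xi /andP[cxi xiL] ->] := IH (beta - 1) c Lp (lt_trans x0 xc).
exists xi.
  rewrite (le_trans (ltW xc) cxi) (le_trans xiL) // big_cons addrA lerD2r.
  exact: ltW.
rewrite big_cons big_ord_recl subr0.
have -> : beta - 1 - (size L)%:R = beta - (size L).+1%:R.
  by rewrite -natr1; ring.
have -> : \prod_(i < size L) (beta - 1 - i%:R) =
          \prod_(i < size L) (beta - (lift ord0 i)%:R).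
  by apply: eq_bigr => i _; rewrite /= /bump add1n -natr1; ring.
by ring.
Qed.

Lemma powR_natSy (R : realType) (gamma : R) : 0 < gamma ->
  (fun n : nat => n.+1%:R `^ gamma) @ \oo --> +oo.
Proof.
move=> g0; apply/cvgryPge => A.
near=> n; apply: (le_trans (ler_norm A)).
have -> : `|A| = (`|A| `^ gamma^-1) `^ gamma.
  by rewrite -powRrM mulVf ?powRr1 // gt_eqF.
apply: ge0_ler_powR; rewrite ?nnegrE ?powR_ge0 ?(ltW g0) //.
apply: (@le_trans _ _ n%:R); last by rewrite ler_nat.
by near: n; exact: nbhs_infty_ger.
Unshelve. all: by end_near. Qed.

Lemma powR_natSN (R : realType) (gamma : R) : gamma < 0 ->
  (fun n : nat => n.+1%:R `^ gamma) @ \oo --> (0 : R).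
Proof.
move=> g0; have /powR_natSy : 0 < - gamma by rewrite oppr_gt0.
move=> h.
rewrite (_ : (fun n : nat => _) =
    unstable.inv_fun (fun n : nat => n.+1%:R `^ (- gamma))).
  by apply/gtr0_cvgV0 => //; apply: nearW => n; exact: powR_gt0.
by apply/funext => n /=; rewrite powRN invrK.
Qed.

Lemma powR_le_neg (R : realType) (gamma x y : R) :
  gamma <= 0 -> 0 < x -> x <= y -> y `^ gamma <= x `^ gamma.
Proof.
move=> g0 x0 xy; rewrite -[gamma]opprK !(powRN _ (- gamma)).
have y0 := lt_le_trans x0 xy.
rewrite lef_pV2 ?posrE ?powR_gt0 //.
by apply: ge0_ler_powR; rewrite ?nnegrE ?oppr_ge0 // ltW.
Qed.

Lemma mdiff_powR_cvg0 (R : realType) (L : seq R) (beta : R) :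
  {in L, forall s, 0 < s} -> beta < (size L)%:R ->
  (fun n => mdiff L (@powR R ^~ beta) n.+1%:R) @ \oo --> (0 : R).
Proof.
move=> Lp bL.
set C := (\prod_(s <- L) s) * (\prod_(i < size L) (beta - i%:R)).
have lim : (fun n => `|C| * n.+1%:R `^ (beta - (size L)%:R)) @ \oo --> (0 : R).
  rewrite -[X in _ --> X](mulr0 `|C|); apply: cvgMl_tmp.
  by apply: powR_natSN; rewrite subr_lt0.
apply/norm_cvg0P; apply: (squeeze_cvgr _ (cvg_cst _) lim); apply: nearW => n.
rewrite normr_ge0 /=.
have [//|xi /andP[nxi _] ->] := @mdiff_powR R L beta n.+1%:R Lp _.
rewrite normrM ler_wpM2l // ger0_norm ?powR_ge0 //.
by apply: powR_le_neg => //; rewrite subr_le0 ltW.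
Qed.

Lemma falling_gt0 (R : realType) (d : nat) (alpha : R) :
  d%:R < alpha -> 0 < \prod_(i < d.+1) (alpha - i%:R).
Proof.
move=> da; apply: prodr_gt0 => i _; rewrite subr_gt0 (le_lt_trans _ da) //.
by rewrite ler_nat -ltnS.
Qed.

Lemma mdiff_powR_gt0 (R : realType) (L : seq R) (d : nat) (alpha x : R) :
  {in L, forall s, 0 < s} -> size L = d.+1 -> d%:R < alpha -> 0 < x ->
  0 < mdiff L (@powR R ^~ alpha) x.
Proof.
move=> Lp sL da x0; have [xi /andP[xxi _] ->] := mdiff_powR alpha Lp x0.
have xi0 := lt_le_trans x0 xxi.
rewrite sL !mulr_gt0 ?powR_gt0 ?falling_gt0 //.
by rewrite big_seq; apply: prodr_gt0 => s; exact: Lp.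
Qed.

Lemma mdiff_powR_lt0 (R : realType) (L : seq R) (d : nat) (alpha x : R) :
  {in L, forall s, 0 < s} -> size L = d.+2 -> d%:R < alpha < d.+1%:R -> 0 < x ->
  mdiff L (@powR R ^~ alpha) x < 0.
Proof.
move=> Lp sL /andP[da ad] x0; have [xi /andP[xxi _] ->] := mdiff_powR alpha Lp x0.
have xi0 := lt_le_trans x0 xxi.
rewrite sL pmulr_llt0 ?powR_gt0 // pmulr_rlt0; last first.
  by rewrite big_seq; apply: prodr_gt0 => s; exact: Lp.
by rewrite big_ord_recr pmulr_rlt0 ?falling_gt0 // subr_lt0.
Qed.

(** The difference is of the order of [n `^ (alpha - d - 1)], negative exponent but
    above [-1], so that multiplying it by [n] leaves a positive power. *)
Lemma mdiff_powR_growth (R : realType) (L : seq R) (d : nat) (alpha : R) :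
  {in L, forall s, 0 < s} -> size L = d.+1 -> d%:R < alpha < d.+1%:R ->
  (fun n => n.+1%:R * mdiff L (@powR R ^~ alpha) n.+1%:R) @ \oo --> +oo.
Proof.
move=> Lp sL /andP[da ad].
have L0 : 0 <= \sum_(s <- L) s.
  by rewrite big_seq; apply: sumr_ge0 => s sL'; exact/ltW/Lp.
set S := 1 + \sum_(s <- L) s.
have S0 : 0 < S by rewrite /S ltr_pwDl.
set C := (\prod_(s <- L) s) * (\prod_(i < size L) (alpha - i%:R)).
have C0 : 0 < C.
  rewrite /C sL mulr_gt0 ?falling_gt0 //.
  by rewrite big_seq; apply: prodr_gt0 => s; exact: Lp.
set C' := C * S `^ (alpha - d.+1%:R).
have C'0 : 0 < C' by rewrite mulr_gt0 // powR_gt0.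
have /cvgryPge lim := @powR_natSy R (alpha - d%:R) ltac:(by rewrite subr_gt0).
apply/cvgryPge => A; apply: filterS (lim (A / C')) => n.
rewrite ler_pdivrMr // => /le_trans; apply.
have n0 : 0 < n.+1%:R :> R by [].
have [xi /andP[nxi xin] ->] := mdiff_powR alpha Lp n0.
rewrite -/C sL.
have -> : n.+1%:R `^ (alpha - d%:R) = n.+1%:R * n.+1%:R `^ (alpha - d.+1%:R) :> R.
  rewrite -[X in X * _]powRr1 // -powRD; last by apply/implyP => _; rewrite gt_eqF.
  by congr (_ `^ _); rewrite -natr1; ring.
rewrite (_ : _ * _ * C' = C * (n.+1%:R *
  (n.+1%:R `^ (alpha - d.+1%:R) * S `^ (alpha - d.+1%:R)))); last by rewrite /C'; ring.
rewrite [leRHS]mulrCA; apply: ler_wpM2l; first exact: ltW.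
apply: ler_wpM2l => //; rewrite -powRM // ?(ltW S0) //.
apply: powR_le_neg.
- by rewrite subr_le0 ltW.
- exact: lt_le_trans nxi.
- apply: (le_trans xin); rewrite /S mulrDr mulr1 lerD2l.
  by rewrite ler_peMl // ler1n.
Qed.

(** * Weyl sums *)

(** The linear functional ['X^i |-> g i].  For [g i = u (n + i)] it is the value at
    [n] of the polynomial [h] in the shift operator applied to [u], and the
    product of polynomials is the composition of operators; see [umbralM]. *)
Definition umbral (V : zmodType) (h : {poly int}) (g : nat -> V) : V :=
  \sum_(i < size h) g i *~ h`_i.

Lemma umbral_wide (V : zmodType) n (h : {poly int}) (g : nat -> V) :
  (size h <= n)%N -> umbral h g = \sum_(i < n) g i *~ h`_i.
Proof.
move=> hn; rewrite /umbral -!(big_mkord xpredT (fun i => g i *~ h`_i)).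
rewrite [in RHS](big_cat_nat (leq0n _) hn) /= [X in _ + X](_ : _ = 0) ?addr0 //.
rewrite big_nat_cond big1 // => i /andP[/andP[hi _] _].
by rewrite nth_default // mulr0z.
Qed.

Lemma umbralD (V : zmodType) (h1 h2 : {poly int}) (g : nat -> V) :
  umbral (h1 + h2) g = umbral h1 g + umbral h2 g.
Proof.
rewrite !(@umbral_wide _ (maxn (size h1) (size h2))) ?leq_maxl ?leq_maxr ?size_polyD //.
by rewrite -big_split; apply: eq_bigr => i _; rewrite coefD mulrzDr.
Qed.

Lemma umbralCM (V : zmodType) (c : int) (h : {poly int}) (g : nat -> V) :
  umbral (c%:P * h) g = umbral h g *~ c.
Proof.
rewrite mul_polyC (@umbral_wide _ (size h)) ?size_scale_leq //.
rewrite [RHS]mulrz_suml; apply: eq_bigr => i _.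
by rewrite coefZ mulrC mulrzA.
Qed.

Lemma umbralB (V : zmodType) (h1 h2 : {poly int}) (g : nat -> V) :
  umbral (h1 - h2) g = umbral h1 g - umbral h2 g.
Proof.
by rewrite umbralD -mulN1r -polyCN umbralCM mulrNz mulr1z.
Qed.

Lemma umbral0 (V : zmodType) (g : nat -> V) : umbral 0 g = 0.
Proof. by rewrite /umbral size_poly0 big_ord0. Qed.

Lemma umbral1 (V : zmodType) (g : nat -> V) : umbral 1 g = g 0%N.
Proof. by rewrite /umbral size_poly1 big_ord1 coef1 mulr1z. Qed.

Lemma umbralMX (V : zmodType) (h : {poly int}) (g : nat -> V) :
  umbral (h * 'X) g = umbral h (fun i => g i.+1).
Proof.
rewrite (@umbral_wide _ (size h).+1); last first.
  by rewrite (leq_trans (size_polyMleq _ _)) // size_polyX addn2.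
rewrite big_ord_recl coefMX /= mulr0z add0r; apply: eq_bigr => i _.
by rewrite coefMX.
Qed.

Lemma umbralM (V : zmodType) (h1 h2 : {poly int}) (g : nat -> V) :
  umbral (h1 * h2) g = umbral h1 (fun i => umbral h2 (fun l => g (i + l)%N)).
Proof.
elim/poly_ind: h1 g => [|h c IH] g; first by rewrite mul0r !umbral0.
rewrite mulrDl -mulrA (mulrC 'X) mulrA !umbralD !umbralMX umbralCM IH; congr (_ + _).
by rewrite -[c%:P]mulr1 umbralCM umbral1.
Qed.

Lemma umbralMXn (V : zmodType) (h : {poly int}) m (g : nat -> V) :
  umbral (h * 'X^m) g = umbral h (fun i => g (i + m)%N).
Proof.
rewrite umbralM; congr (umbral _ _); apply/funext => i.
rewrite (@umbral_wide _ m.+1) ?size_polyXn // big_ord_recr /= coefXn eqxx mulr1z.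
rewrite big1 ?add0r // => l _.
by rewrite coefXn (ltn_eqF (ltn_ord l)) mulr0z.
Qed.

Lemma umbral_XsubC1 (V : zmodType) m (g : nat -> V) :
  umbral (('X - 1%:P) ^+ m) g = iter m (@fdiff V) g 0%N.
Proof.
elim: m g => [|m IH] g; first by rewrite umbral1.
rewrite exprSr umbralM iterSr -IH; congr (umbral _ _); apply/funext => i.
by rewrite umbralB -['X]mul1r umbralMX !umbral1 addn1 addn0.
Qed.

Lemma cvg_sum0 (R : realType) (I : Type) (s : seq I) (a : I -> nat -> R) :
  (forall i, a i @ \oo --> (0 : R)) ->
  (fun n => \sum_(i <- s) a i n) @ \oo --> (0 : R).
Proof.
move=> a0; elim: s => [|i s IH].
  by under eq_fun do rewrite big_nil; exact: cvg_cst.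
under eq_fun do rewrite big_cons.
have h : a i \+ (fun n => \sum_(j <- s) a j n) @ \oo --> (0 + 0 : R).
  exact: cvgD.
rewrite addr0 in h; exact: h.
Qed.

Section weyl.
Context {R : realType} (alpha : R) (d r : nat).
Hypotheses (alpha_in : d%:R < alpha < d.+1%:R) (r_gt0 : (0 < r)%N).

(** The index is shifted by one to keep the base of the power positive, as the mean
    value theorem requires. *)
Definition power_orbit (n i : nat) : R := (n + r * i).+1%:R `^ alpha.

Let steps_gt0 m : {in nseq m r%:R, forall s : R, 0 < s}.
Proof. by move=> s /nseqP[-> _]; rewrite ltr0n. Qed.

Let steps1_gt0 m : {in 1 :: nseq m r%:R, forall s : R, 0 < s}.
Proof. by move=> s; rewrite inE => /predU1P[->//|]; exact: steps_gt0. Qed.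

Let steps11_gt0 m : {in 1 :: 1 :: nseq m r%:R, forall s : R, 0 < s}.
Proof. by move=> s; rewrite inE => /predU1P[->//|]; exact: steps1_gt0. Qed.

Lemma iter_fdiff_power_orbit m n i :
  iter m (@fdiff R) (power_orbit n) i =
  mdiff (nseq m r%:R) (@powR R ^~ alpha) (n + r * i).+1%:R.
Proof.
have -> : power_orbit n = fun l => (n.+1%:R + r%:R * l%:R) `^ alpha.
  by apply/funext => l; rewrite /power_orbit -addSn natrD natrM.
by rewrite (@iter_fdiff_mdiff R (@powR R ^~ alpha)) -addSn natrD natrM.
Qed.

Lemma iter_fdiff_power_orbit_cvg0 m i : (d < m)%N ->
  (fun n => iter m (@fdiff R) (power_orbit n) i) @ \oo --> (0 : R).
Proof.
move=> dm; under eq_fun do rewrite iter_fdiff_power_orbit.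
have /andP[_ ad] := alpha_in.
have am : alpha < (size (nseq m (r%:R : R)))%:R.
  by rewrite size_nseq (lt_le_trans ad) // ler_nat.
have := mdiff_powR_cvg0 (@steps_gt0 m) am.
by rewrite -(cvg_shiftn (r * i)).
Qed.

(** Split [g] as [g.[1]] plus a multiple of ['X - 1].  The second part only sees
    differences of order [d.+1], which tend to [0]; the first part is a multiple of
    the difference of order [d], to which [fejer] applies. *)
Lemma weyl_sum_base (g : {poly int}) theta : g.[1] != 0 ->
  has_mean (fun n => cos (2 * pi * umbral (g * ('X - 1%:P) ^+ d) (power_orbit n)
                          + theta)) 0.
Proof.
move=> g1.
have /factor_theorem[g2 g2E] : root (g - g.[1]%:P) 1.
  by rewrite rootE !hornerE subrr.
have gE : g = g2 * ('X - 1%:P) + g.[1]%:P by rewrite -g2E subrK.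
(* The phase up to [o(1)]. *)
pose psi n := 2 * pi * (iter d (@fdiff R) (power_orbit n) 0%N *~ g.[1]) + theta.
apply: (@has_mean_cos_eq R _ psi).
  rewrite (_ : _ \- _ = fun n => 2 * pi *
      umbral g2 (iter d.+1 (@fdiff R) (power_orbit n))).
    rewrite -[X in _ --> X](mulr0 (2 * pi)); apply: cvgMl_tmp.
    apply: cvg_sum0 => i; rewrite -[X in _ --> X](mulr0 (g2`_i)%:~R).
    under eq_fun do rewrite -mulrzl.
    by apply: cvgMl_tmp; exact: iter_fdiff_power_orbit_cvg0.
  apply/funext => n /=; rewrite /psi.
  have -> : umbral (g * ('X - 1%:P) ^+ d) (power_orbit n) =
      umbral g2 (iter d.+1 (@fdiff R) (power_orbit n)) +
      iter d (@fdiff R) (power_orbit n) 0%N *~ g.[1].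
    rewrite [in LHS]gE mulrDl umbralD umbralCM umbral_XsubC1 -mulrA -exprS umbralM.
    congr (umbral _ _ + _); apply/funext => i; rewrite umbral_XsubC1.
    have -> : (fun l => power_orbit n (i + l)%N) = power_orbit (n + r * i).
      by apply/funext => l; rewrite /power_orbit mulnDr addnA.
    by rewrite !iter_fdiff_power_orbit muln0 addn0.
  by rewrite mulrDr -[_ + _ + theta]addrA addrK.
have c0 : 2 * pi * g.[1]%:~R != 0 :> R.
  by rewrite !mulf_neq0 ?intr_eq0 // gt_eqF // pi_gt0.
apply: (@fejer R psi (fun n => mdiff (1 :: nseq d r%:R) (@powR R ^~ alpha) n.+1%:R) _ c0).
- move=> n; rewrite /psi !iter_fdiff_power_orbit !muln0 !addn0 /= natr1.
  by rewrite opprD addrACA subrr addr0 -mulrBr -mulrzBl -mulrzl mulrA.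
- move=> n; apply: (@mdiff_powR_gt0 R _ d) => //=; rewrite ?size_nseq //.
  by case/andP: alpha_in.
- move=> n; rewrite -subr_le0 -[n.+2%:R]natr1; apply: ltW.
  by apply: (@mdiff_powR_lt0 R (1 :: 1 :: nseq d r%:R) d) => //=; rewrite size_nseq.
- apply: mdiff_powR_cvg0 => //=; rewrite size_nseq.
  by case/andP: alpha_in.
- by apply: (@mdiff_powR_growth R _ d) => //=; rewrite size_nseq.
Qed.

(** Induction on the defect [e] of the order of vanishing at [1].  Shifting by
    [r * m] multiplies the polynomial by ['X^m], so that van der Corput's
    difference has the polynomial [('X^m - 1) * h], where ['X^m - 1] is ['X - 1]
    times a polynomial with value [m <> 0] at [1]. *)
Lemma weyl_sum_vanishing e (g : {poly int}) theta : (e <= d)%N -> g.[1] != 0 ->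
  has_mean (fun n => cos (2 * pi *
    umbral (g * ('X - 1%:P) ^+ (d - e)) (power_orbit n) + theta)) 0.
Proof.
elim: e g theta => [|e IH] g theta ed g1.
  by rewrite subn0; exact: weyl_sum_base.
apply: (@van_der_corput R _ r) => m m0.
pose g' := g * \sum_(i < m) 'X^i.
have g'1 : g'.[1] != 0.
  rewrite hornerM horner_sum (eq_bigr (fun=> 1)) ?sumr_const ?card_ord.
    by rewrite mulf_neq0 // pnatr_eq0 -lt0n.
  by move=> i _; rewrite hornerXn expr1n.
have := IH g' 0 (ltnW ed) g'1; congr (has_mean _ _); apply/funext => n.
rewrite addr0 -mulrBr; congr (cos (_ * _)).
have -> : umbral (g * ('X - 1%:P) ^+ (d - e.+1)) (power_orbit (n + r * m)) =
          umbral (g * ('X - 1%:P) ^+ (d - e.+1) * 'X^m) (power_orbit n).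
  rewrite umbralMXn; congr (umbral _ _); apply/funext => i.
  by rewrite /power_orbit -addnA -mulnDr addnC (addnC i) addnC.
rewrite -umbralB; congr (umbral _ _); rewrite -[X in _ = _ - X]mulr1 -mulrBr subrX1 /g'.
rewrite -polyC1 -(subnSK ed) exprSr -!mulrA; congr (_ * _).
by rewrite mulrC -mulrA.
Qed.

Lemma weyl_sum (h : {poly int}) theta : h != 0 -> (size h <= d.+1)%N ->
  has_mean (fun n => cos (2 * pi * umbral h (power_orbit n) + theta)) 0.
Proof.
move=> h0 hd; have [m [q]] := multiplicity_XsubC h 1.
rewrite h0 /= => q1 hE.
have md : (m <= d)%N.
  have q0 : q != 0 by apply: contraNneq q1 => ->; rewrite root0.
  move: hd; rewrite hE size_Mmonic ?monic_exp ?monicXsubC // size_exp_XsubC addnS /=.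
  have : (0 < size q)%N by rewrite size_poly_gt0.
  by case: (size q) => // s _; rewrite addSn ltnS; exact/leq_trans/leq_addl.
by rewrite hE -(subKn md); apply: weyl_sum_vanishing; rewrite ?leq_subr // -rootE.
Qed.
End weyl.

(** * The Fejer kernel *)

(** The Fejer kernel of order [Q] divided by [Q], which makes its [Q] translates by
    the multiples of [1 / Q] a partition of unity ([sum_kernel]). *)
Definition kernel (R : realType) (Q : nat) (t : R) : R :=
  Q%:R^-2 * \sum_(a < Q) \sum_(b < Q) cos (2 * pi * (a%:Z - b%:Z)%:~R * t).

Lemma kernel_sqr (R : realType) Q (t : R) :
  kernel Q t = Q%:R^-2 * ((\sum_(a < Q) cos (a%:R * (2 * pi * t))) ^+ 2 +
                          (\sum_(a < Q) sin (a%:R * (2 * pi * t))) ^+ 2).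
Proof.
rewrite /kernel; congr (_ * _); rewrite !expr2 !mulr_suml -big_split.
apply: eq_bigr => a _ /=; rewrite !mulr_sumr -big_split; apply: eq_bigr => b _ /=.
by rewrite -cosB -mulrBl intrD intrN; congr cos; rewrite !pmulrn; ring.
Qed.

Lemma kernel_ge0 (R : realType) Q (t : R) : 0 <= kernel Q t.
Proof.
by rewrite kernel_sqr mulr_ge0 ?invr_ge0 ?exprn_ge0 // addr_ge0 // sqr_ge0.
Qed.

(** Multiplying the sum of the [Q] exponentials by [e^{ix} - 1] telescopes to
    [e^{iQx} - 1]; compare the squared moduli. *)
Lemma kernel_decay (R : realType) Q (t : R) :
  kernel Q t * (1 - cos (2 * pi * t)) <= 2 * Q%:R^-2.
Proof.
rewrite kernel_sqr -[_ * _ * (1 - _)]mulrA [leRHS]mulrC.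
apply: ler_wpM2l; first by rewrite invr_ge0 exprn_ge0.
set x := 2 * pi * t.
set C := \sum_(a < Q) cos _; set S := \sum_(a < Q) sin _.
have e1 : (cos x - 1) * C - sin x * S = cos (Q%:R * x) - 1.
  rewrite -[X in _ = _ - X]cos0 -(mul0r x).
  rewrite -(@telescope_sumr _ 0 Q (fun a => cos (a%:R * x))) // big_mkord.
  rewrite /C /S !mulr_sumr -sumrB; apply: eq_bigr => a _.
  have -> : a.+1%:R * x = a%:R * x + x by rewrite -natr1 mulrDl mul1r.
  by rewrite cosD; ring.
have e2 : sin x * C + (cos x - 1) * S = sin (Q%:R * x).
  rewrite -[RHS]subr0 -[X in _ = _ - X]sin0 -(mul0r x).
  rewrite -(@telescope_sumr _ 0 Q (fun a => sin (a%:R * x))) // big_mkord.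
  rewrite /C /S !mulr_sumr -big_split; apply: eq_bigr => a _ /=.
  have -> : a.+1%:R * x = a%:R * x + x by rewrite -natr1 mulrDl mul1r.
  by rewrite sinD; ring.
have h1 := cos2Dsin2 x; have h2 := cos2Dsin2 (Q%:R * x).
have h3 := cos_geN1 (Q%:R * x).
have : 2 * ((C ^+ 2 + S ^+ 2) * (1 - cos x)) = 2 - 2 * cos (Q%:R * x).
  have -> : 2 * ((C ^+ 2 + S ^+ 2) * (1 - cos x)) =
    ((cos x - 1) * C - sin x * S) ^+ 2 + (sin x * C + (cos x - 1) * S) ^+ 2 +
    (C ^+ 2 + S ^+ 2) * (1 - (cos x ^+ 2 + sin x ^+ 2)) by ring.
  rewrite e1 e2 h1 subrr mulr0 addr0 -[X in _ = X - _]mulr1 -[X in _ = 2 * X - _]h2.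
  move: h2; set c := cos _; set s := sin _ => h2.
  have -> : (c - 1) ^+ 2 + s ^+ 2 = c ^+ 2 + s ^+ 2 + 1 - 2 * c by ring.
  by rewrite h2; ring.
by move=> h; rewrite -(ler_pM2l (_ : 0 < 2)) // h; lra.
Qed.

Lemma cosDint (R : realType) (x : R) (m : int) : cos (x + 2 * pi * m%:~R) = cos x.
Proof.
have cosDn n y : cos (y + 2 * pi * n%:R) = cos y :> R.
  by rewrite -(periodicn (@cosD2pi R) n y); by rewrite mulr_natr mulr_natl.
case: m => n; first by rewrite -pmulrn cosDn.
by rewrite NegzE mulrNz mulrN -[LHS](cosDn n.+1) subrK.
Qed.

Lemma cos_near_int (R : realType) (eta t : R) : 0 <= eta <= 1 / 2 ->
  cos (2 * pi * eta) < cos (2 * pi * t) ->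
  `|t - (Num.floor (t + 1 / 2))%:~R| < eta.
Proof.
move=> /andP[e0 e2] ct; set m := Num.floor _.
have /andP[m1 m2] := floor_itv (t + 1 / 2); rewrite -/m in m1 m2.
have tm : `|t - m%:~R| <= 1 / 2.
  by move: m2; rewrite intrD rmorph1 ler_norml => m2; apply/andP; split; lra.
have pi0 := pi_gt0 R.
have le_pi (y : R) : 0 <= y -> y <= 1 / 2 -> 2 * pi * y \in `[0, pi].
  move=> y0 y2; rewrite in_itv /= !mulr_ge0 ?(ltW pi0) //=.
  by rewrite (le_trans (ler_wpM2l _ y2)) ?mulr_ge0 ?(ltW pi0) //; lra.
have cE : cos (2 * pi * t) = cos (2 * pi * `|t - m%:~R|).
  have [_|_] := ler0P (t - m%:~R); last first.
    by rewrite -[RHS](cosDint _ m); congr cos; ring.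
  by rewrite mulrN cosN -[RHS](cosDint _ m); congr cos; ring.
move: ct; rewrite cE ltr_cos ?le_pi //.
by rewrite ltr_pM2l // mulr_gt0.
Qed.

(** For [a <> b] the sum [S x] is invariant under the rotation by the angle [w]
    between consecutive terms.  Hence [2 * S x = S (x + w) + S (x - w)], which is
    also [2 * cos w * S x], while [cos w < 1]. *)
Lemma sum_cos_roots (R : realType) (Q a b : nat) (x : R) :
  (a < Q)%N -> (b < Q)%N ->
  \sum_(q < Q) cos (x - 2 * pi * (a%:Z - b%:Z)%:~R * (q%:R / Q%:R)) =
  (a == b)%:R * Q%:R * cos x.
Proof.
move=> aQ bQ; have [->|ab] := eqVneq a b.
  rewrite mul1r (eq_bigr (fun=> cos x)); last first.
    by move=> q _; rewrite subrr mulr0 mul0r subr0.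
  by rewrite sumr_const card_ord mulr_natl.
have Q0 : (0 < Q)%N by exact: leq_ltn_trans aQ.
have Qn0 : Q%:R != 0 :> R by rewrite pnatr_eq0 -lt0n.
rewrite /= !mul0r; pose w : R := 2 * pi * (a%:Z - b%:Z)%:~R / Q%:R.
pose S y : R := \sum_(q < Q) cos (y - w * q%:R).
rewrite (_ : \sum_(q < Q) _ = S x); last first.
  by apply: eq_bigr => q _; congr cos; rewrite /w; ring.
have Sw y : S (y + w) = S y.
  rewrite /S -(prednK Q0) big_ord_recl [RHS]big_ord_recr /= [LHS]addrC.
  congr (_ + _).
    by apply: eq_bigr => q _; rewrite /= /bump add1n -natr1; congr cos; ring.
  rewrite mulr0 subr0 -[RHS](cosDint _ (a%:Z - b%:Z)); congr cos.
  have -> : Q.-1%:R = Q%:R - 1 :> R by rewrite -[in RHS](prednK Q0) -natr1 addrK.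
  rewrite -!addrA; congr (_ + _); rewrite /w; field => //.
have Sww : S (x + w) + S (x - w) = 2 * cos w * S x.
  rewrite /S mulr_sumr -big_split; apply: eq_bigr => q _ /=.
  have -> : x + w - w * q%:R = (x - w * q%:R) + w by ring.
  have -> : x - w - w * q%:R = (x - w * q%:R) - w by ring.
  by move: (x - w * q%:R) => z; rewrite cosD cosB; ring.
have w1 : cos w < 1.
  have m0 : 0 < `|(a%:Z - b%:Z)%:~R : R|.
    by rewrite normr_gt0 intr_eq0 subr_eq0 eqz_nat.
  have mQ : `|(a%:Z - b%:Z)%:~R : R| < Q%:R.
    have aQ' : a%:R < Q%:R :> R by rewrite ltr_nat.
    have bQ' : b%:R < Q%:R :> R by rewrite ltr_nat.
    have a0 : 0 <= a%:R :> R by []. have b0 : 0 <= b%:R :> R by [].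
    by rewrite intrD intrN -!pmulrn ltr_norml; apply/andP; split; lra.
  pose y : R := pi * (`|(a%:Z - b%:Z)%:~R| / Q%:R).
  have wy : cos w = cos (y *+ 2).
    rewrite -cos_norm; congr cos; rewrite /w /y !normrM normfV.
    by rewrite (ger0_norm (pi_ge0 R)) !(ger0_norm (ler0n R _)); ring.
  have siny : 0 < sin y.
    apply: sin_gt0_pi; rewrite /y mulr_gt0 ?pi_gt0 ?divr_gt0 ?ltr0n //=.
    by rewrite -[ltRHS]mulr1 ltr_pM2l ?pi_gt0 // ltr_pdivrMr ?ltr0n // mul1r.
  rewrite wy cos_mulr2n cos2sin2 -mulr_natl.
  have : 0 < sin y ^+ 2 by rewrite exprn_gt0.
  by lra.
have : (1 - cos w) * S x = 0.
  have := Sw (x - w); rewrite subrK => xw.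
  by move: Sww; rewrite Sw -xw => h; rewrite mulrBl mul1r; lra.
by move=> /eqP; rewrite mulf_eq0 subr_eq0 gt_eqF //= => /eqP.
Qed.

Lemma sum_kernel (R : realType) Q (t : R) : (0 < Q)%N ->
  \sum_(q < Q) kernel Q (t - q%:R / Q%:R) = 1.
Proof.
move=> Q0; have Qn0 : Q%:R != 0 :> R by rewrite pnatr_eq0 -lt0n.
rewrite /kernel -mulr_sumr exchange_big /=.
rewrite (eq_bigr (fun=> Q%:R)); last first.
  move=> a _; rewrite exchange_big /= (bigD1 a) //= [X in _ + X]big1 => [|b ba].
    under eq_bigr do rewrite mulrBr.
    by rewrite sum_cos_roots // eqxx subrr mulr0 mul0r cos0 addr0 mul1r mulr1.
  under eq_bigr do rewrite mulrBr.
  by rewrite sum_cos_roots // eq_sym (inj_eq val_inj) (negbTE ba) /= !mul0r.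
by rewrite sumr_const card_ord -mulr_natr; field.
Qed.

Section kernel_mean.
Context {R : realType} (alpha : R) (d r Q : nat).
Hypotheses (alpha_in : d%:R < alpha < d.+1%:R) (r_gt0 : (0 < r)%N) (Q_gt0 : (0 < Q)%N).
Variable tau : nat -> R.

(** The kernels are absorbed one coordinate at a time.  Expanding the [i]-th kernel
    and using [2 cos y cos z = cos (y + z) + cos (y - z)] adds or subtracts a
    multiple of ['X^i] to [h], whose coefficient at ['X^i] is still [0]; so the new
    polynomial is zero only if [h] is and if the multiple is trivial. *)
Lemma kernel_mean_step i (h : {poly int}) theta : (i <= d.+1)%N ->
  (size h <= d.+1)%N -> (forall l, (l < i)%N -> h`_l = 0) ->
  has_mean (fun n => cos (2 * pi * umbral h (power_orbit alpha r n) + theta) *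
                     \prod_(l < i) kernel Q (power_orbit alpha r n l - tau l))
           ((h == 0)%:R * cos theta * Q%:R ^- i).
Proof.
have Qn0 : Q%:R != 0 :> R by rewrite pnatr_eq0 -lt0n.
elim: i h theta => [|i IH] h theta id hd h_low.
  rewrite (_ : (fun n => _) =
      fun n => cos (2 * pi * umbral h (power_orbit alpha r n) + theta)); last first.
    by apply/funext => n; rewrite big_ord0 mulr1.
  rewrite expr0 invr1 mulr1; have [->|h0] := eqVneq h 0.
    rewrite mul1r (_ : (fun n => _) = fun=> cos theta); first exact: has_mean_cst.
    by apply/funext => n; rewrite umbral0 mulr0 add0r.
  by rewrite mul0r; exact: (weyl_sum alpha_in r_gt0 theta h0 hd).
pose c (a b : 'I_Q) : int := a%:Z - b%:Z.
pose th (a b : 'I_Q) : R := 2 * pi * (c a b)%:~R * tau i.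
pose term (s : int) (a b : 'I_Q) n :=
  cos (2 * pi * umbral (h + (s * c a b)%:P * 'X^i) (power_orbit alpha r n)
       + (theta - s%:~R * th a b)) *
  \prod_(l < i) kernel Q (power_orbit alpha r n l - tau l).
have mean_term s a b : s != 0 -> has_mean (term s a b)
    ((h == 0)%:R * (a == b)%:R * cos theta * Q%:R ^- i).
  move=> s0; have hi : h`_i = 0 by apply: h_low.
  have := IH (h + (s * c a b)%:P * 'X^i) (theta - s%:~R * th a b) (ltnW id).
  have -> : (h + (s * c a b)%:P * 'X^i == 0) = (h == 0) && (a == b).
    have [ab|ab] := eqVneq a b.
      by rewrite /c ab subrr mulr0 mul0r addr0 andbT.
    rewrite andbF; apply/eqP => /(congr1 (fun p : {poly int} => p`_i)).
    rewrite coefD coefMXn ltnn subnn coefC eqxx hi add0r coef0 => /eqP.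
    by rewrite mulf_eq0 (negbTE s0) subr_eq0 eqz_nat (inj_eq val_inj) (negbTE ab).
  rewrite -mulnb natrM.
  have -> : (h == 0)%:R * (a == b)%:R * cos (theta - s%:~R * th a b) * Q%:R ^- i =
            (h == 0)%:R * (a == b)%:R * cos theta * Q%:R ^- i :> R.
    have [->|] := eqVneq a b; last by rewrite !mulr0 !mul0r.
    by rewrite /th /c subrr mulr0 mul0r mulr0 subr0.
  apply.
    rewrite (leq_trans (size_polyD _ _)) // geq_max hd /= mul_polyC.
    by rewrite (leq_trans (size_scale_leq _ _)) // size_polyXn.
  by move=> l li; rewrite coefD h_low ?coefMXn ?li ?addr0 // ltnW.
have half (x : R) : 2^-1 * (x + x) = x by lra.
have -> : (h == 0)%:R * cos theta * Q%:R ^- i.+1 = Q%:R^-2 *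
    \sum_(a < Q) \sum_(b < Q) 2^-1 *
      ((h == 0)%:R * (a == b)%:R * cos theta * Q%:R ^- i +
       (h == 0)%:R * (a == b)%:R * cos theta * Q%:R ^- i) :> R.
  rewrite (eq_bigr (fun=> (h == 0)%:R * cos theta * Q%:R ^- i)); last first.
    move=> a _; rewrite (bigD1 a) //= eqxx big1 ?addr0 ?mulr1 ?half // => b.
    by rewrite eq_sym half => /negbTE ->; rewrite mulr0 !mul0r.
  by rewrite sumr_const card_ord -mulr_natr exprSr; field; rewrite expf_neq0.
rewrite (_ : (fun n => _) = fun n => Q%:R^-2 * \sum_(a < Q) \sum_(b < Q) 2^-1 *
    (term 1 a b n + term (-1) a b n)).
  apply: has_meanZ; apply: has_mean_sum => a _; apply: has_mean_sum => b _.
  by apply: has_meanZ; apply: has_meanD; exact: mean_term.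
apply/funext => n; rewrite big_ord_recr /= mulrA mulrC {1}/kernel -[LHS]mulrA.
congr (_ * _); rewrite mulr_suml; apply: eq_bigr => a _.
rewrite mulr_suml; apply: eq_bigr => b _.
pose A := umbral h (power_orbit alpha r n); pose B := power_orbit alpha r n i.
have phase s : 2 * pi * umbral (h + (s * c a b)%:P * 'X^i) (power_orbit alpha r n)
    + (theta - s%:~R * th a b) =
    (2 * pi * A + theta) + s%:~R * (2 * pi * (c a b)%:~R * (B - tau i)).
  rewrite umbralD umbralCM -['X^i]mul1r umbralMXn umbral1 add0n -/A -/B -mulrzl intrM /th.
  by ring.
rewrite /term !phase -/(c a b) -/A -/B rmorph1 rmorphN1 [1 * _]mul1r [-1 * _]mulN1r.
move: (2 * pi * A + theta) (2 * pi * (c a b)%:~R * (B - tau i)) => y z.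
by rewrite cosD cosB; field.
Qed.

Lemma kernel_mean :
  has_mean (fun n => \prod_(l < d.+1) kernel Q (power_orbit alpha r n l - tau l))
           (Q%:R ^- d.+1).
Proof.
have := @kernel_mean_step d.+1 0 0 (leqnn _).
rewrite size_poly0 => /(_ isT (fun l _ => coef0 _ l)).
rewrite eqxx cos0 !mul1r; congr (has_mean _ _); apply/funext => n.
by rewrite umbral0 mulr0 addr0 cos0 mul1r.
Qed.
End kernel_mean.

(** * Cells of the torus and lattice points *)

Lemma extrapolateZ (R : pzRingType) D (c : R) (g : nat -> R) j :
  extrapolate D (fun i => c * g i) j = c * extrapolate D g j.
Proof.
have itZ i n : iter i (@fdiff R) (fun l => c * g l) n = c * iter i (@fdiff R) g n.
  by elim: i n => // i IH n; rewrite /= /fdiff !IH mulrBr.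
rewrite /extrapolate /newton mulr_sumr; apply: eq_bigr => i _.
by rewrite itZ mulrnAr.
Qed.

Lemma extrapolate_intr (R : pzRingType) D (g : nat -> int) j :
  extrapolate D (fun i => (g i)%:~R) j = (extrapolate D g j)%:~R :> R.
Proof. exact: (@extrapolate_raddf int R (intmul 1) D g j). Qed.

(** Only the first [d.+1] terms are meaningful. *)
Definition lattice_seq d T (v : {ffun 'I_d.+1 -> 'I_T}) (i : nat) : int :=
  (v (inord i))%:Z.

(** The integer-valued polynomials of degree at most [d] with values in [0, T) at
    all [j < k], given by their values at [0, ..., d]. *)
Definition lattice_points k d T : {set {ffun 'I_d.+1 -> 'I_T}} :=
  [set v | [forall j : 'I_k, 0 <= extrapolate d.+1 (lattice_seq v) j < T%:Z]].

Lemma lattice_pointsP k d T (v : {ffun 'I_d.+1 -> 'I_T}) :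
  reflect (forall j, (j < k)%N -> 0 <= extrapolate d.+1 (lattice_seq v) j < T%:Z)
          (v \in lattice_points k d T).
Proof.
rewrite inE; apply: (iffP forallP) => [h j jk|h j]; last exact: h.
exact: (h (Ordinal jk)).
Qed.

Section cells.
Context {R : realType} (d Q : nat).
Hypothesis Q_gt0 : (0 < Q)%N.

(** The kernel on the torus of dimension [d.+1] centred at the corner [w / Q] of a
    cell. *)
Definition bump (x : nat -> R) (w : {ffun 'I_d.+1 -> 'I_Q}) : R :=
  \prod_(l < d.+1) kernel Q (x l - (w l)%:R / Q%:R).

Definition far (x : nat -> R) (kappa : R) (w : {ffun 'I_d.+1 -> 'I_Q}) : bool :=
  [exists l : 'I_d.+1, cos (2 * pi * (x l - (w l)%:R / Q%:R)) <= 1 - kappa].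

Lemma bump_ge0 x w : 0 <= bump x w.
Proof. by apply: prodr_ge0 => l _; exact: kernel_ge0. Qed.

Lemma sum_bump x : \sum_w bump x w = 1.
Proof.
rewrite -(bigA_distr_bigA (fun (l : 'I_d.+1) (q : 'I_Q) => kernel Q (x l - q%:R / Q%:R))) /=.
by rewrite big1 // => l _; exact: sum_kernel.
Qed.

(** For each coordinate [l], dropping the condition on the other coordinates leaves a
    product of sums of kernels, all equal to [1] but for the [l]-th, where
    [kernel_decay] applies. *)
Lemma sum_bump_far x kappa : 0 < kappa ->
  \sum_(w | far x kappa w) bump x w <= 2 * d.+1%:R / (kappa * Q%:R).
Proof.
move=> k0; have Qp : 0 < Q%:R :> R by rewrite ltr0n.
pose farl (l : 'I_d.+1) (q : 'I_Q) := cos (2 * pi * (x l - q%:R / Q%:R)) <= 1 - kappa.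
pose G (l i : 'I_d.+1) (q : 'I_Q) :=
  (if i == l then (farl l q)%:R else 1) * kernel Q (x i - q%:R / Q%:R) : R.
have GE l (w : {ffun 'I_d.+1 -> 'I_Q}) : (farl l (w l))%:R * bump x w = \prod_i G l i (w i).
  rewrite /G big_split /= -/(bump x w); congr (_ * _).
  by rewrite (bigD1 l) //= eqxx big1 ?mulr1 // => i /negbTE ->.
have far_le (w : {ffun 'I_d.+1 -> 'I_Q}) :
    (far x kappa w)%:R * bump x w <= \sum_l \prod_i G l i (w i).
  under eq_bigr do rewrite -GE.
  rewrite -mulr_suml ler_wpM2r ?bump_ge0 //.
  case: (boolP (far x kappa w)) => [/existsP[l fl]|_]; last exact: sumr_ge0.
  by rewrite (bigD1 l) //= {1}/farl fl lerDl sumr_ge0.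
have Gl l : \sum_(w : {ffun 'I_d.+1 -> 'I_Q}) \prod_i G l i (w i) <= 2 / (kappa * Q%:R).
  rewrite -(bigA_distr_bigA (G l)) (bigD1 l) //= [X in _ * X]big1 => [|i il].
    rewrite mulr1; apply: (@le_trans _ _ (\sum_(q < Q) 2 * Q%:R^-2 / kappa)).
      apply: ler_sum => q _; rewrite /G eqxx /farl.
      case: (leP (cos _) (1 - kappa)) => fq; rewrite ?mul0r ?mul1r; last first.
        by rewrite divr_ge0 ?mulr_ge0 ?invr_ge0 ?exprn_ge0 // ltW.
      rewrite ler_pdivlMr //.
      apply: le_trans (kernel_decay Q (x l - q%:R / Q%:R)).
      by rewrite ler_wpM2l ?kernel_ge0 //; lra.
    rewrite sumr_const card_ord -[_ *+ Q]mulr_natr.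
    suff -> : 2 * Q%:R^-2 / kappa * Q%:R = 2 / (kappa * Q%:R) :> R by [].
    by field; rewrite !gt_eqF.
  rewrite /G (negbTE il); under eq_bigr do rewrite mul1r.
  exact: sum_kernel.
rewrite big_mkcond /=.
apply: (@le_trans _ _ (\sum_(w : {ffun 'I_d.+1 -> 'I_Q}) \sum_l \prod_i G l i (w i))).
  by apply: ler_sum => w _; apply: le_trans (far_le w); case: ifP; rewrite ?mul1r ?mul0r.
rewrite exchange_big /=; apply: (@le_trans _ _ (\sum_(l < d.+1) 2 / (kappa * Q%:R))).
  by apply: ler_sum => l _; exact: Gl.
by rewrite sumr_const card_ord -[_ *+ d.+1]mulr_natr mulrAC.
Qed.

(** The integer nearest to [x i - w i / Q] realizes the distance on the circle. *)
Lemma near_cell x (eta : R) (w : {ffun 'I_d.+1 -> 'I_Q}) (i : nat) :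
  0 <= eta <= 1 / 2 -> ~~ far x (1 - cos (2 * pi * eta)) w -> (i < d.+1)%N ->
  `|Q%:R * (x i - (Num.floor (x i - (lattice_seq w i)%:~R / Q%:R + 1 / 2))%:~R)
    - (lattice_seq w i)%:~R| <= Q%:R * eta.
Proof.
move=> eta2; rewrite negb_exists => /forallP h id.
have := h (Ordinal id); rewrite -ltNge subKr => /(cos_near_int eta2).
have <- : inord i = Ordinal id by apply: val_inj; rewrite /= inordK.
rewrite /= inordK // /lattice_seq -pmulrn; set m := Num.floor _.
move=> /ltW; have Qp : 0 < Q%:R :> R by rewrite ltr0n.
rewrite -(ler_pM2l Qp) -{1}(ger0_norm (ltW Qp)) -normrM; congr (`|_| <= _).
by field; rewrite gt_eqF.
Qed.
End cells.

Arguments sum_bump {R d Q}.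
Arguments sum_bump_far {R d Q}.

Section cell_sets.
Variables (k d Q K : nat).
Hypothesis Q_gt0 : (0 < Q)%N.

(** Cells on which the floors certainly extrapolate, because the values of their
    polynomial stay at distance [K] from the ends of [0, Q). *)
Definition lower_cells : {set {ffun 'I_d.+1 -> 'I_Q}} :=
  [set w | [forall j : 'I_k,
     K%:Z <= extrapolate d.+1 (lattice_seq w) j < Q%:Z - K%:Z]].

(** Cells that a point whose floors extrapolate may be close to.  Such a cell has a
    representative modulo [Q] with values in [-K, Q + K); it is shifted by [K] to
    become a lattice point, and [K * Q.-1] is [- K] modulo [Q]. *)
Definition upper_cells : {set {ffun 'I_d.+1 -> 'I_Q}} :=
  [set w : {ffun 'I_d.+1 -> 'I_Q} | [exists v in lattice_points k d (Q + K.*2),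
     [forall i, ((v i + K * Q.-1) %% Q)%N == w i]]].

Lemma card_upper_cells : (#|upper_cells| <= #|lattice_points k d (Q + K.*2)|)%N.
Proof.
pose rho (v : {ffun 'I_d.+1 -> 'I_(Q + K.*2)}) : {ffun 'I_d.+1 -> 'I_Q} :=
  [ffun i => Ordinal (ltn_pmod (v i + K * Q.-1) Q_gt0)].
apply: leq_trans (leq_imset_card rho _); apply: subset_leq_card.
apply/fintype.subsetP => w; rewrite inE => /exists_inP[v vL /forallP vw].
apply/imsetP; exists v => //; apply/ffunP => i; rewrite ffunE; apply: val_inj => /=.
by rewrite (eqP (vw i)).
Qed.

(** Adding [K] to all values embeds the smaller set of lattice points. *)
Lemma card_lower_cells :
  (K.*2 <= Q)%N -> (#|lattice_points k d (Q - K.*2)| <= #|lower_cells|)%N.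
Proof.
move=> KQ.
have lt_sigma (o : 'I_(Q - K.*2)) : (o + K < Q)%N by have := ltn_ord o; lia.
pose sigma (v : {ffun 'I_d.+1 -> 'I_(Q - K.*2)}) : {ffun 'I_d.+1 -> 'I_Q} :=
  [ffun i => Ordinal (lt_sigma (v i))].
rewrite -(@card_imset _ _ sigma); last first.
  move=> u v uv; apply/ffunP => i; apply: val_inj.
  have /(congr1 (fun w : {ffun 'I_d.+1 -> 'I_Q} => w i : nat)) := uv.
  by rewrite !ffunE /=; lia.
apply: subset_leq_card; apply/fintype.subsetP => _ /imsetP[v vL ->].
rewrite inE; apply/forallP => j.
have -> : extrapolate d.+1 (lattice_seq (sigma v)) j =
          extrapolate d.+1 (lattice_seq v) j + K%:Z.
  rewrite -[K%:Z]opprK -(extrapolate_cst d (- K%:Z) j) -extrapolateB.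
  by apply: eq_extrapolate => i id; rewrite /lattice_seq ffunE /= opprK.
have /lattice_pointsP/(_ _ (ltn_ord j))/andP[h1 h2] := vL.
by apply/andP; split; lia.
Qed.
End cell_sets.

Section floors.
Context {R : realType} (k d Q K : nat) (y : nat -> R) (eta eps : R).
Hypotheses (Q_gt0 : (0 < Q)%N) (dk : (d < k)%N) (eta_in : 0 <= eta <= 1 / 2).
Hypothesis eps_small : forall j, (j < k)%N -> `|y j - extrapolate d.+1 y j| <= eps.
Hypothesis K_large : Q%:R * (eta *+ extrapolation_bound d.+1 k + eps) <= K%:R.

Let kappa : R := 1 - cos (2 * pi * eta).

Definition floors_extrapolate : Prop :=
  forall j, (j < k)%N ->
    Num.floor (y j) = extrapolate d.+1 (fun i => Num.floor (y i)) j.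

Let offset (w : {ffun 'I_d.+1 -> 'I_Q}) (i : nat) : int :=
  Num.floor (y i - (lattice_seq w i)%:~R / Q%:R + 1 / 2).

(** Extrapolation of the approximation [near_cell], together with the error of the
    extrapolation of [y] itself. *)
Let offset_error w j : ~~ far y kappa w -> (j < k)%N ->
  `|Q%:R * (y j - (extrapolate d.+1 (offset w) j)%:~R)
    - (extrapolate d.+1 (lattice_seq w) j)%:~R| <= K%:R.
Proof.
move=> nfar jk; apply: le_trans K_large.
have Qp : 0 < Q%:R :> R by rewrite ltr0n.
pose a i : R := Q%:R * (y i - (offset w i)%:~R) - (lattice_seq w i)%:~R.
have ha : `|extrapolate d.+1 a j| <= (Q%:R * eta) *+ extrapolation_bound d.+1 k.
  apply: extrapolate_norm => //; first by rewrite mulr_ge0 //; case/andP: eta_in.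
  by move=> l ld; exact: near_cell.
have aE : extrapolate d.+1 a j =
    Q%:R * (extrapolate d.+1 y j - (extrapolate d.+1 (offset w) j)%:~R)
    - (extrapolate d.+1 (lattice_seq w) j)%:~R.
  by rewrite extrapolateB extrapolateZ extrapolateB !extrapolate_intr.
have he : `|Q%:R * (y j - extrapolate d.+1 y j)| <= Q%:R * eps.
  by rewrite normrM ger0_norm // ler_wpM2l // eps_small.
rewrite [leRHS]mulrDr mulrnAr.
apply: le_trans (lerD ha he); apply: le_trans (ler_normD _ _).
by rewrite le_eqVlt; apply/orP; left; apply/eqP; congr `|_|; rewrite aE; ring.
Qed.

(** By [offset_error] the numbers [y j] minus the extrapolated offset stay in
    [0, 1), so that the floors are the extrapolated offset. *)
Lemma floors_of_lower_cell w :
  w \in lower_cells k d Q K -> ~~ far y kappa w -> floors_extrapolate.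
Proof.
rewrite inE => /forallP low nfar.
have Qp : 0 < Q%:R :> R by rewrite ltr0n.
have floorE j : (j < k)%N -> Num.floor (y j) = extrapolate d.+1 (offset w) j.
  move=> jk; apply/floor_def; have := offset_error nfar jk.
  have /andP[] := low (Ordinal jk).
  rewrite /= -(ler_int R) -(ltr_int R) intrB -!pmulrn ler_norml.
  move: (extrapolate _ _ _) (extrapolate _ _ _) => z m z1 z2 /andP[h1 h2].
  rewrite intrD rmorph1 -subr_ge0 -(pmulr_rge0 _ Qp).
  rewrite -ltrBlDl -(ltr_pM2l Qp) mulr1; apply/andP; split; lra.
move=> j jk; rewrite floorE //; apply: eq_extrapolate => i id.
by rewrite floorE ?extrapolate_low // (leq_trans id).
Qed.

(** The representative [z] of [w] corrected by the floors of [y] is within [K] of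
    [Q] times the fractional parts of the [y j]. *)
Lemma upper_cell_of_floors w :
  floors_extrapolate -> ~~ far y kappa w -> w \in upper_cells k d Q K.
Proof.
move=> fl nfar; have Qp : 0 < Q%:R :> R by rewrite ltr0n.
pose z i : int := lattice_seq w i + Q%:Z * (offset w i - Num.floor (y i)).
have zE j : extrapolate d.+1 z j = extrapolate d.+1 (lattice_seq w) j +
    Q%:Z * (extrapolate d.+1 (offset w) j - extrapolate d.+1 (fun i => Num.floor (y i)) j).
  have -> : z = fun i => lattice_seq w i - Q%:Z * (Num.floor (y i) - offset w i).
    by apply/funext => i; rewrite /z; ring.
  by rewrite extrapolateB extrapolateZ extrapolateB; ring.
have z_in j : (j < k)%N -> - K%:Z <= extrapolate d.+1 z j < Q%:Z + K%:Z.
  move=> jk; rewrite zE -fl //; have := offset_error nfar jk.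
  rewrite -(ler_int R) -(ltr_int R) !intrD intrM intrB intrN -!pmulrn.
  have /andP := floor_itv (y j); rewrite intrD rmorph1.
  move: (extrapolate _ _ _) (extrapolate _ _ _) => a m [h1 h2].
  have {}h1 : 0 <= Q%:R * (y j - (Num.floor (y j))%:~R) by rewrite mulr_ge0 // subr_ge0.
  have {}h2 : Q%:R * (y j - (Num.floor (y j))%:~R) < Q%:R.
    by rewrite -[ltRHS]mulr1 ltr_pM2l // ltrBlDl.
  by rewrite ler_norml => /andP[h3 h4]; apply/andP; split; lra.
have z_low i : (i < d.+1)%N -> - K%:Z <= z i < Q%:Z + K%:Z.
  by move=> id; rewrite -(extrapolate_low z id) z_in // (leq_trans id).
have /fin_all_exists[v vE] (i : 'I_d.+1) :
    exists o : 'I_(Q + K.*2), o%:Z = z i + K%:Z.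
  have /andP[z1 z2] := z_low i (ltn_ord i).
  have oT : (`|z i + K%:Z : int|%N < Q + K.*2)%N by lia.
  by exists (Ordinal oT) => /=; lia.
rewrite inE; apply/exists_inP; exists [ffun i => v i].
  apply/lattice_pointsP => j jk.
  have -> : extrapolate d.+1 (lattice_seq [ffun i => v i]) j =
            extrapolate d.+1 z j + K%:Z.
    rewrite -[K%:Z]opprK -(extrapolate_cst d (- K%:Z) j) -extrapolateB.
    apply: eq_extrapolate => i id; rewrite /lattice_seq ffunE vE inordK //.
    by rewrite opprK.
  by have /andP[] := z_in j jk; rewrite -addnn; lia.
apply/forallP => i; rewrite ffunE.
have /= := vE i; rewrite /z /lattice_seq inord_val.
set m := offset w i - _ => vi.
rewrite -eqz_nat -modz_nat PoszD vi.
have -> : (w i)%:Z + Q%:Z * m + K%:Z + (K * Q.-1)%N%:Z = (m + K%:Z) * Q%:Z + (w i)%:Z.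
  have -> : (K * Q.-1)%N%:Z = K%:Z * (Q%:Z - 1).
    by rewrite PoszM; congr (_ * _); lia.
  by ring.
by rewrite modzMDl modz_small // ltz_nat ltn_ord.
Qed.

End floors.

(** * The volume by counting cubes *)

(** A common form for the region C_{k,d+1} and for the sets of partial sums of the
    lower bound. *)
Definition slabs (R : realType) (n k : nat) (a : nat -> nat -> R) (s : R) :
    set (n.-tuple R) :=
  [set t | forall j, (j < k)%N -> 0 <= s + \sum_(i < n) a j i * tnth t i < 1].

Arguments slabs {R} n k a s.

Lemma measurable_slabs (R : realType) n k (a : nat -> nat -> R) (s : R) :
  measurable (slabs n k a s).
Proof.
have mL j : measurable_fun [set: n.-tuple R]
    (fun t => s + \sum_(i < n) a j i * tnth t i).
  apply: measurable_funD => //; apply: measurable_sum => i.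
  by apply: measurable_funM => //; exact: measurable_tnth.
rewrite (_ : slabs n k a s = \bigcap_(j in `I_k)
    ((fun t => s + \sum_(i < n) a j i * tnth t i) @^-1` `[0, 1[)).
  apply: fin_bigcap_measurable => [|j _]; first exact: finite_II.
  by rewrite -[X in measurable X]setTI; apply: mL.
by apply/seteqP; split=> t /= h j jk; have := h j jk; rewrite /= in_itv.
Qed.

Lemma poly_regionE (R : realType) k d : (0 < k)%N ->
  poly_region R k d = slabs d.+1 k (fun j i => 'C(j, i)%:R) 0.
Proof.
move=> k0; have E0 (t : d.+1.-tuple R) :
    0 + \sum_(i < d.+1) 'C(0, i)%:R * tnth t i = tnth t ord0.
  rewrite add0r big_ord_recl bin0 mul1r big1 ?addr0 // => i _.
  by rewrite bin0n mul0r.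
apply/seteqP; split=> t /=.
  move=> [h0 h] [|j] jk; first by rewrite E0.
  by rewrite add0r; exact: h.
move=> h; split; first by rewrite -E0; exact: h.
by move=> j /andP[_ jk]; have := h j jk; rewrite add0r.
Qed.

Definition tuple_seq (R : realType) d (y : d.+1.-tuple R) (i : nat) : R :=
  tnth y (inord i).

Lemma slabs_newton (R : realType) k d (y : d.+1.-tuple R) : 
  slabs d.+1 k (fun j i => 'C(j, i)%:R) 0 y <->
  forall j, (j < k)%N -> 0 <= newton d.+1 (tuple_seq y) j < 1.
Proof.
suff E j : newton d.+1 (tuple_seq y) j =
    0 + \sum_(i < d.+1) 'C(j, i)%:R * tnth y i.
  by split=> h j jk; have := h j jk; rewrite E.
rewrite add0r; apply: eq_bigr => i _.
by rewrite /tuple_seq inord_val mulr_natl.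
Qed.

Definition cube (R : realType) d (Q : nat) (q : nat -> int) : set (d.+1.-tuple R) :=
  [set y | forall i : 'I_d.+1,
     `[(q i)%:~R / Q%:R, ((q i)%:~R + 1) / Q%:R[%classic (tnth y i)].

Lemma measurable_cube (R : realType) d Q (q : nat -> int) :
  measurable (@cube R d Q q).
Proof.
apply: (@measurable_tuple_box R d.+1
  (fun i => `[(q i)%:~R / Q%:R, ((q i)%:~R + 1) / Q%:R[%classic)) => i.
exact: measurable_itv.
Qed.

Lemma lebesgue_cube (R : realType) d Q (q : nat -> int) : (0 < Q)%N ->
  lebesgue_tuple d.+1 (@cube R d Q q) = (Q%:R ^- d.+1)%:E.
Proof.
move=> Q0; have Qp : 0 < Q%:R :> R by rewrite ltr0n.
rewrite /cube (@lebesgue_tuple_box R d.+1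
  (fun i => `[(q i)%:~R / Q%:R, ((q i)%:~R + 1) / Q%:R[%classic)) => [|i]; last first.
  exact: measurable_itv.
rewrite (eq_bigr (fun=> (Q%:R^-1)%:E)) => [|i _].
  by rewrite prodEFin prodr_const card_ord exprVn.
rewrite lebesgue_measure_itv /= lte_fin ltr_pM2r ?invr_gt0 // ltrDl ltr01.
by rewrite -EFinB mulrDl addrAC subrr add0r mul1r.
Qed.

Lemma cubeP (R : realType) d Q (q : nat -> int) (y : d.+1.-tuple R) : (0 < Q)%N ->
  cube Q q y <->
  forall i, (i < d.+1)%N -> (q i)%:~R <= Q%:R * tuple_seq y i < (q i)%:~R + 1.
Proof.
move=> Q0; have Qp : 0 < Q%:R :> R by rewrite ltr0n.
split=> [h i id|h i] /=.
  have := h (inord i); rewrite /= in_itv /= inordK // ler_pdivrMr // ltr_pdivlMr //.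
  by rewrite mulrC.
have := h i (ltn_ord i); rewrite /tuple_seq inord_val in_itv /=.
by rewrite ler_pdivrMr // ltr_pdivlMr // mulrC.
Qed.

(** Rounding the coordinates in the binomial basis down to integers changes the
    values at [j < k] by at most this number. *)
Definition rounding_bound (d k : nat) : nat := \sum_(j < k) \sum_(i < d.+1) 'C(j, i).

Lemma newton_rounding (R : realType) d k Q (q : nat -> int) (y : d.+1.-tuple R) j :
  (0 < Q)%N -> (j < k)%N -> cube Q q y ->
  (newton d.+1 q j)%:~R <= Q%:R * newton d.+1 (tuple_seq y) j <=
  (newton d.+1 q j)%:~R + (rounding_bound d k)%:R.
Proof.
move=> Q0 jk /(cubeP _ _ Q0) h.
have -> : (newton d.+1 q j)%:~R = \sum_(i < d.+1) (q i)%:~R *+ 'C(j, i) :> R.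
  rewrite /newton raddf_sum; apply: eq_bigr => i _ /=.
  exact: rmorphMn.
rewrite /newton mulr_sumr; apply/andP; split.
  apply: ler_sum => i _; rewrite mulrnAr lerMn2r.
  by have /andP[->] := h i (ltn_ord i); rewrite orbT.
apply: (@le_trans _ _ (\sum_(i < d.+1) ((q i)%:~R + 1) *+ 'C(j, i))).
  apply: ler_sum => i _; rewrite mulrnAr lerMn2r.
  by have /andP[_ /ltW ->] := h i (ltn_ord i); rewrite orbT.
under eq_bigr do rewrite mulrnDl.
rewrite big_split lerD2l /= -natr_sum ler_nat.
by rewrite /rounding_bound (bigD1 (Ordinal jk)) //= leq_addr.
Qed.

(** The integer point of the cube attached to [v]: the coordinates in the binomial
    basis of the polynomial with values [v], lowered by the constant [c]. *)
Definition cube_corner d T (c : int) (v : {ffun 'I_d.+1 -> 'I_T}) (i : nat) : int :=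
  iter i (@fdiff int) (fun l => lattice_seq v l - c) 0%N.

Lemma newton_cube_corner d T c (v : {ffun 'I_d.+1 -> 'I_T}) j :
  newton d.+1 (cube_corner c v) j = extrapolate d.+1 (lattice_seq v) j - c.
Proof. by rewrite -[X in _ - X](extrapolate_cst d c j) -extrapolateB. Qed.

(** The corner is the integer part of [Q y], and determines the values of its
    polynomial by Newton's formula. *)
Lemma cube_inj (R : realType) d T Q (c : int) (u v : {ffun 'I_d.+1 -> 'I_T})
    (y : d.+1.-tuple R) : (0 < Q)%N ->
  cube Q (cube_corner c u) y -> cube Q (cube_corner c v) y -> u = v.
Proof.
move=> Q0 /(cubeP _ _ Q0) hu /(cubeP _ _ Q0) hv.
have E i : (i < d.+1)%N -> cube_corner c u i = cube_corner c v i.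
  move=> id; rewrite -(floor_def (m := cube_corner c u i) (x := Q%:R * tuple_seq y i)).
    by apply: floor_def; rewrite intrD rmorph1; exact: hv.
  by rewrite intrD rmorph1; exact: hu.
apply/ffunP => i; apply: val_inj.
have := eq_newton i E; rewrite !newton_cube_corner !extrapolate_low //.
by move=> /addIr; rewrite /lattice_seq inord_val => -[].
Qed.

Section volume.
Context {R : realType} (k d Q : nat).
Hypotheses (dk : (d < k)%N) (Q_gt0 : (0 < Q)%N).
Local Notation mu := (@lebesgue_tuple R d.+1).
Local Notation K := (rounding_bound d k).

Let sum_cubes T (c : int) (A : {set {ffun 'I_d.+1 -> 'I_T}}) :
  (\sum_(v \in [set` enum A]) mu (cube Q (cube_corner c v)))%E =
  (#|A|%:R / Q%:R ^+ d.+1)%:E.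
Proof.
rewrite -fsbig_seq ?enum_uniq //.
rewrite (eq_bigr (fun=> (Q%:R ^- d.+1)%:E)) => [|v _]; last exact: lebesgue_cube.
by rewrite sumEFin big_enum sumr_const mulr_natl.
Qed.

Let k_gt0 : (0 < k)%N. Proof. exact: leq_ltn_trans dk. Qed.

(** The cubes of the lattice points with values in [0, Q - K) are disjoint and lie
    in the region, as rounding moves the values by at most [K]. *)
Lemma volume_ge_lattice : (K <= Q)%N ->
  ((#|lattice_points k d (Q - K)|%:R / Q%:R ^+ d.+1)%:E <= mu (poly_region R k d))%E.
Proof.
move=> KQ; rewrite poly_regionE // -(sum_cubes 0).
rewrite -measure_fin_bigcup //; last first.
- by move=> v _; exact: measurable_cube.
- apply/trivIsetP => u v _ _ uv; apply/seteqP; split=> // y [yu yv].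
  by move: uv; rewrite (cube_inj Q_gt0 yu yv) eqxx.
apply: le_measure; rewrite ?inE.
- by apply: fin_bigcup_measurable => // v _; exact: measurable_cube.
- exact: measurable_slabs.
move=> y [v /=]; rewrite mem_enum => /lattice_pointsP vL yv.
apply/slabs_newton => j jk; have := newton_rounding Q_gt0 jk yv.
have Qp : 0 < Q%:R :> R by rewrite ltr0n.
rewrite newton_cube_corner subr0 => /andP[h1 h2].
have /andP[v1 v2] := vL j jk.
have {}v1 : 0 <= (extrapolate d.+1 (lattice_seq v) j)%:~R :> R by rewrite ler0z.
have {}v2 : (extrapolate d.+1 (lattice_seq v) j)%:~R + K%:R < Q%:R :> R.
  by rewrite pmulrn -intrD [ltRHS]pmulrn ltr_int; lia.
rewrite -(pmulr_rge0 _ Qp) -(ltr_pM2l Qp) mulr1; apply/andP; split.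
  exact: le_trans h1.
exact: le_lt_trans v2.
Qed.

(** Rounding a point of the region down gives values in [-K, Q), so that the
    cubes with these corners cover it; raising the values by [K] gives lattice
    points. *)
Lemma volume_le_lattice :
  (mu (poly_region R k d) <= (#|lattice_points k d (Q + K)|%:R / Q%:R ^+ d.+1)%:E)%E.
Proof.
rewrite poly_regionE // -(sum_cubes K%:Z).
apply: content_sub_fsum => //.
- by move=> v _; exact: measurable_cube.
- exact: measurable_slabs.
move=> y /slabs_newton yC; have Qp : 0 < Q%:R :> R by rewrite ltr0n.
pose q i := Num.floor (Q%:R * tuple_seq y i).
have yq : cube Q q y.
  apply/(cubeP _ _ Q_gt0) => i _.
  by have := floor_itv (Q%:R * tuple_seq y i); rewrite intrD rmorph1.
have q_in j : (j < k)%N -> - K%:Z <= newton d.+1 q j < Q%:Z.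
  move=> jk; have /andP[h1 h2] := newton_rounding Q_gt0 jk yq.
  have /andP[y1 y2] := yC j jk.
  have {}y1 : 0 <= Q%:R * newton d.+1 (tuple_seq y) j by rewrite mulr_ge0.
  have {}y2 : Q%:R * newton d.+1 (tuple_seq y) j < Q%:R by rewrite gtr_pMr.
  rewrite -(ler_int R) -(ltr_int R) intrN -!pmulrn; apply/andP; split.
    by rewrite lerNl -subr_ge0; lra.
  exact: le_lt_trans y2.
have /fin_all_exists[v vE] (i : 'I_d.+1) :
    exists o : 'I_(Q + K), o%:Z = newton d.+1 q i + K%:Z.
  have /andP[z1 z2] := q_in i (leq_trans (ltn_ord i) dk).
  have oT : (`|newton d.+1 q i + K%:Z : int|%N < Q + K)%N by lia.
  by exists (Ordinal oT) => /=; lia.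
have seqE i : (i < d.+1)%N ->
    lattice_seq [ffun i => v i] i - K%:Z = newton d.+1 q i.
  by move=> id; rewrite /lattice_seq ffunE vE inordK // addrK.
exists [ffun i => v i] => /=.
  rewrite mem_enum; apply/lattice_pointsP => j jk.
  have -> : extrapolate d.+1 (lattice_seq [ffun i => v i]) j =
            newton d.+1 q j + K%:Z.
    rewrite -(extrapolate_newton d.+1 q j) -(eq_extrapolate j seqE).
    by rewrite extrapolateB extrapolate_cst subrK.
  by have /andP[h1 h2] := q_in j jk; apply/andP; split; lia.
apply/(cubeP _ _ Q_gt0) => i id.
have -> : cube_corner K%:Z [ffun i => v i] i = q i.
  rewrite /cube_corner -[RHS](iter_fdiff_newton0 q id).
  by apply: eq_iter_fdiff => l li; apply: seqE; exact: leq_ltn_trans li id.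
by move/(cubeP _ _ Q_gt0): yq; apply.
Qed.
End volume.

(** * The lower bound for the volume *)

Definition partial_sums (R : realType) n (c : nat -> R) (s : R) : set (n.-tuple R) :=
  slabs n n (fun m i => (i <= m)%N%:R * c i) s.
Arguments partial_sums {R} n c s.

Lemma partial_sums_cons (R : realType) n (c : nat -> R) (s x : R) (t : n.-tuple R) :
  partial_sums n.+1 c s (tuple_cons (x, t)) <->
  0 <= s + c 0%N * x < 1 /\ partial_sums n (fun i => c i.+1) (s + c 0%N * x) t.
Proof.
have E m : s + \sum_(i < n.+1) ((i <= m)%N%:R * c i) * tnth (tuple_cons (x, t)) i =
    s + c 0%N * x + \sum_(i < n) ((i < m)%N%:R * c i.+1) * tnth t i.
  rewrite big_ord_recl tnth0 mul1r addrA; congr (_ + _).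
  by apply: eq_bigr => i _; rewrite tnthS.
have E0 : s + c 0%N * x + \sum_(i < n) ((i < 0)%N%:R * c i.+1) * tnth t i = s + c 0%N * x.
  by rewrite big1 ?addr0 // => i _; rewrite !mul0r.
split=> [h|[h0 h] [|m] mn].
- split; first by rewrite -E0 -E; exact: h.
  by move=> m mn; have := h m.+1 mn; rewrite E.
- by rewrite E E0.
- by rewrite E; exact: h.
Qed.

(** Slicing by the first coordinate: when the first partial sum is in [0, 1), which
    happens on an interval of length [1 / c 0], the slice is a set of the same kind
    with another starting point [s], and its measure does not depend on [s]. *)
Lemma lebesgue_partial_sums (R : realType) n (c : nat -> R) (s : R) :
  (forall i, (i < n)%N -> 0 < c i) ->
  lebesgue_tuple n (partial_sums n c s) = (\prod_(i < n) (c i)^-1)%:E.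
Proof.
elim: n c s => [|n IH] c s c0.
  by rewrite big_ord0 /= diracE mem_set.
have c00 : 0 < c 0%N by exact: c0.
pose p : R := \prod_(i < n) (c i.+1)^-1.
have p0 : 0 <= p.
  by apply: prodr_ge0 => i _; rewrite invr_ge0; apply/ltW/c0; rewrite ltnS.
pose I : set R := `[- s / c 0%N, (1 - s) / c 0%N[%classic.
have IE x : I x <-> 0 <= s + c 0%N * x < 1.
  rewrite /I /= in_itv /= ler_pdivrMr // ltr_pdivlMr // lerNl -subr_ge0 opprK.
  by rewrite ltrBrDl (mulrC x) addrC.
rewrite /= /prod_lebesgue /pushforward /product_measure1.
transitivity (\int[@lebesgue_measure R]_x ((\1_I x)%:E * p%:E))%E.
  apply: eq_integral => x _ /=; rewrite indicE; have [xI|xI] := boolP (x \in I).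
    rewrite mul1e; transitivity
        (lebesgue_tuple n (partial_sums n (fun i => c i.+1) (s + c 0%N * x))).
      congr (lebesgue_tuple n _); apply/seteqP; split=> t; rewrite /xsection /= inE /=.
        by move/partial_sums_cons => [].
      by move=> h; apply/partial_sums_cons; split => //; apply/IE; rewrite inE in xI.
    by apply: IH => i ni; exact: c0.
  rewrite mul0e (_ : xsection _ _ = set0) ?measure0 //.
  apply/seteqP; split=> t //; rewrite /xsection /= inE /= => /partial_sums_cons[h _].
  by move/negP: xI; apply; rewrite inE; apply/IE.
rewrite ge0_integralZr //; last first.
  by apply/measurable_EFinP; apply: measurable_indic; exact: measurable_itv.
have mI : measurable I by exact: measurable_itv.
have -> : (\int[@lebesgue_measure R]_x (\1_I x)%:E)%E = lebesgue_measure I.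
  have := @integral_indic _ _ R (@lebesgue_measure R) setT measurableT I mI.
  by rewrite setIT.
rewrite /I lebesgue_measure_itv /= lte_fin ltr_pM2r ?invr_gt0 //.
rewrite ltrDr ltr01 -EFinB -EFinM; congr (_%:E).
rewrite big_ord_recl /= -/p; have : c 0%N != 0 by rewrite gt_eqF.
by move: (c 0%N) => x x0; field.
Qed.

(** Abel summation, one step at a time: the sum is [s * (W - w 0)] plus the same
    expression for the tail, started at the partial sum [s + c 0 * x] with the
    total weight [w 0]. *)
Lemma abel_bounds (R : realType) n (c w : nat -> R) (s W : R) (t : n.-tuple R) :
  (forall i, 0 <= w i) -> (forall i, w i.+1 <= w i) -> w 0%N <= W -> 0 <= s < 1 ->
  partial_sums n c s t ->
  0 <= s * W + \sum_(i < n) w i * c i * tnth t i <= W /\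
  (0 < W -> s * W + \sum_(i < n) w i * c i * tnth t i < W).
Proof.
elim: n c w s W t => [|n IH] c w s W t w0 wS wW s01.
  rewrite big_ord0 addr0 => _; have W0 : 0 <= W := le_trans (w0 0%N) wW.
  by case/andP: s01 => s0 s1; split; nra.
case/tupleP: t => x t /partial_sums_cons[sx ht].
have [h1 h2] := IH _ (fun i => w i.+1) _ (w 0%N) t
  (fun i => w0 i.+1) (fun i => wS i.+1) (wS 0%N) sx ht.
rewrite big_ord_recl tnth0 /=.
under eq_bigr do rewrite tnthS.
move: h1 h2; set T := \sum_(i < n) _ => h1 h2.
have -> : s * W + (w 0%N * c 0%N * x + T) =
    s * (W - w 0%N) + ((s + c 0%N * x) * w 0%N + T) by ring.
move: h1 h2; set V := _ * w 0%N + T => /andP[v0 vw] v1.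
have ww0 := w0 0%N; case/andP: s01 => s0 s1.
split.
  by apply/andP; split; nra.
move=> W0; have [w00|w00] := ltP 0 (w 0%N); first by have := v1 w00; nra.
have w0E : w 0%N = 0 by apply/eqP; rewrite eq_le w00 ww0.
by move: v0 vw; rewrite w0E subr0 => v0 vw; nra.
Qed.

(** The quotient of the two sides is [(j - i) / (n - i)]. *)
Lemma bin_ratio_le (R : realType) (j n i : nat) : (j <= n)%N ->
  'C(j, i.+1)%:R / 'C(n, i.+1)%:R <= 'C(j, i)%:R / 'C(n, i)%:R :> R.
Proof.
move=> jn; have [ni|ni] := leqP n i.
  by rewrite (@bin_small n i.+1) // invr0 mulr0 divr_ge0.
have p1 : (0 < 'C(n, i.+1))%N by rewrite bin_gt0.
have p2 : (0 < 'C(n, i))%N by rewrite bin_gt0 ltnW.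
rewrite ler_pdivrMr ?ltr0n // mulrAC ler_pdivlMr ?ltr0n // -!natrM ler_nat.
rewrite -(leq_pmul2l (ltn0Sn i)) mulnA mul_bin_left.
rewrite [leqRHS]mulnCA mul_bin_left.
rewrite -!mulnA mulnCA leq_mul // [leqRHS]mulnC mulnC leq_mul //.
by rewrite leq_sub2r.
Qed.

Lemma partial_sums_sub (R : realType) k d : (d < k)%N ->
  partial_sums d.+1 (fun i => 'C(k - 1, i)%:R) 0 `<=`
  slabs d.+1 k (fun j i => 'C(j, i)%:R : R) 0.
Proof.
move=> dk t ht j jk.
have jk1 : (j <= k - 1)%N by lia.
pose w i : R := 'C(j, i)%:R / 'C(k - 1, i)%:R.
have w00 : w 0%N <= 1 by rewrite /w !bin0 divr1.
have [] := @abel_bounds R d.+1 _ w 0 1 t _ _ w00 _ ht.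
- by move=> i; rewrite divr_ge0.
- by move=> i; exact: bin_ratio_le.
- by rewrite lexx ltr01.
have -> : \sum_(i < d.+1) w i * 'C(k - 1, i)%:R * tnth t i =
          \sum_(i < d.+1) 'C(j, i)%:R * tnth t i.
  apply: eq_bigr => i _; rewrite /w divfK // pnatr_eq0 -lt0n bin_gt0.
  by have := ltn_ord i; lia.
by rewrite mul0r => /andP[-> _] /(_ ltr01) ->.
Qed.

Lemma volume_lower_bound (R : realType) k d : (d < k)%N ->
  (((\prod_(1 <= i < d.+1) 'C(k - 1, i)%:R)^-1)%:E
        <= lebesgue_tuple d.+1 (poly_region R k d))%E.
Proof.
move=> dk.
have cp i : (i < d.+1)%N -> 0 < 'C(k - 1, i)%:R :> R.
  by move=> id; rewrite ltr0n bin_gt0; lia.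
have -> : (\prod_(1 <= i < d.+1) 'C(k - 1, i)%:R)^-1 =
          \prod_(i < d.+1) 'C(k - 1, i)%:R^-1 :> R.
  rewrite prodfV; congr (_^-1).
  by rewrite -(big_mkord xpredT (fun i => 'C(k - 1, i)%:R)) [RHS]big_ltn // bin0 mul1r.
rewrite -(lebesgue_partial_sums 0 cp) poly_regionE; last exact: leq_ltn_trans dk.
apply: le_measure; rewrite ?inE; try exact: measurable_slabs.
exact: partial_sums_sub.
Qed.

(** * The density *)

Lemma iter_Delta1 (a : nat -> int) i : iter i (Delta 1) a = iter i (@fdiff int) a.
Proof.
by elim: i => //= i ->; apply/funext => n; rewrite /Delta /fdiff addn1.
Qed.

(** If the differences of order [d] are constant, those of higher order vanish where
    they only involve indices below [k], and [extrapolate_error] gives [A j].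
    Conversely, a polynomial of degree at most [d] has constant differences. *)
Lemma poly_seqsP (k d : nat) (A : nat -> int) : (d < k)%N ->
  (forall j, (j < k)%N -> 0 < A j) ->
  (forall i j, (i < j)%N -> (j < k)%N -> A i < A j) ->
  poly_seqs k d [tuple A j | j < k] <->
  forall j, (j < k)%N -> A j = extrapolate d.+1 A j.
Proof.
move=> dk A0 A_mono.
have nthA j : (j < k)%N -> nth 0 [tuple A j | j < k] j = A j.
  by move=> jk; rewrite -[j]/(val (Ordinal jk)) -tnth_nth tnth_mktuple.
have iterA n : (n < k - d)%N ->
    iter d (Delta 1) (nth 0 [tuple A j | j < k]) n = iter d (@fdiff int) A n.
  move=> nk; rewrite iter_Delta1; apply: eq_iter_fdiff => l ln.
  by apply: nthA; lia.
split=> [[_ _ [c hc]] j jk|hA].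
  apply/eqP; rewrite -subr_eq0 extrapolate_error big_nat_cond big1 //.
  move=> i /andP[/andP[di ij] _].
  have -> : iter i (@fdiff int) A 0%N = 0; last by rewrite mul0rn.
  rewrite -(subnK (ltnW di)) iterD.
  rewrite (@eq_iter_fdiff _ _ (fun=> c)); first by rewrite iter_fdiff_cst0 ?subn_gt0.
  by move=> l li; rewrite -iterA ?hc //; lia.
split=> [j|i j ij|].
- by rewrite tnth_mktuple; exact: A0.
- by rewrite !tnth_mktuple; exact: A_mono.
exists (iter d (@fdiff int) A 0%N) => n nk; rewrite iterA //.
rewrite (@eq_iter_fdiff _ A (extrapolate d.+1 A)); last first.
  by move=> l ln; apply: hA; lia.
rewrite iter_fdiff_newton // subSnn.
by rewrite /newton big_ord1 bin0 addn0 mulr1n.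
Qed.

Lemma cell_bounds (D s c : nat) : (3 <= D)%N -> (c < s)%N ->
  [/\ (0 < D * s)%N, (s.*2 <= D * s)%N, (c < D * s - s.*2)%N & (2 <= D)%N].
Proof.
move=> D3 cs; have Ds : (3 * s <= D * s)%N by rewrite leq_mul2r D3 orbT.
by split; lia.
Qed.

Section density.
Context {R : realType} (alpha : R) (d k r : nat).
Hypotheses (d_gt0 : (0 < d)%N) (alpha_in : d%:R < alpha < d.+1%:R).
Hypotheses (dk : (d + 2 <= k)%N) (r_gt0 : (0 < r)%N).
Local Notation orbit := (power_orbit alpha r).

Let d_lt_k : (d < k)%N. Proof. by lia. Qed.

Let alpha_gt1 : 1 < alpha.
Proof. by case/andP: alpha_in => h _; apply: le_lt_trans h; rewrite ler1n. Qed.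

(** By the mean value theorem, since the derivative of [x `^ alpha] is at least [1]
    on [x >= 1]. *)
Lemma power_orbit_gap n i j : (i < j)%N -> orbit n i + 1 <= orbit n j.
Proof.
move=> ij; pose s : R := (r * (j - i))%N%:R.
have s1 : 1 <= s by rewrite ler1n muln_gt0 r_gt0 subn_gt0.
have sL : {in [:: s], forall t : R, 0 < t}.
  by move=> t; rewrite inE => /eqP ->; exact: lt_le_trans s1.
have x0 : 0 < (n + r * i).+1%:R :> R by [].
have [xi /andP[xxi _]] := mdiff_powR alpha sL x0.
have -> : mdiff [:: s] (@powR R ^~ alpha) (n + r * i).+1%:R = orbit n j - orbit n i.
  rewrite /= /power_orbit; congr (_ `^ _ - _); rewrite /s -natrD; congr (_%:R).
  by rewrite addSn -addnA -mulnDr subnKC // ltnW.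
rewrite big_seq1 big_ord1 subr0 /= => E.
rewrite -lerBrDl E -[X in X <= _](mul1r (1 : R)).
have xi1 : 1 <= xi by apply: le_trans xxi; rewrite ler1n.
apply: ler_pM => //; first by rewrite -[X in X <= _](mul1r (1 : R)) ler_pM // ltW.
rewrite -[X in X <= _](powRr0 xi); apply: ler_powR => //.
by rewrite subr_ge0 ltW.
Qed.

Lemma floor_power_orbit_poly n :
  poly_seqs k d [tuple Num.floor (orbit n j) | j < k] <-> floors_extrapolate k d (orbit n).
Proof.
apply: (@poly_seqsP k d (fun j => Num.floor (orbit n j))) => // [j _|i j ij _].
  rewrite gtz0_ge1 floor_ge_int (_ : 1%:~R = 1 `^ alpha); last by rewrite powR1.
  apply: ge0_ler_powR; rewrite ?nnegrE //.
  - by apply: le_trans (ltW alpha_gt1).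
  - by rewrite ler1n.
have : Num.floor (orbit n i) + 1 <= Num.floor (orbit n j).
  rewrite floor_ge_int intrD rmorph1.
  by apply: le_trans (power_orbit_gap n ij); rewrite lerD2r floor_le.
by lia.
Qed.

Lemma extrapolate_power_orbit_near (eps : R) : 0 < eps ->
  \forall n \near \oo, forall j, (j < k)%N ->
    `|orbit n j - extrapolate d.+1 (orbit n) j| <= eps.
Proof.
move=> e0.
have err0 : (fun n => \sum_(j < k) `|orbit n j - extrapolate d.+1 (orbit n) j|)
    @ \oo --> (0 : R).
  apply: cvg_sum0 => j; apply/norm_cvg0P.
  have -> : (fun n => orbit n j - extrapolate d.+1 (orbit n) j) =
      fun n => \sum_(i <- index_iota d.+1 j.+1)
        if (d < i)%N then 'C(j, i)%:R * iter i (@fdiff R) (orbit n) 0%N else 0.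
    apply/funext => n; rewrite extrapolate_error; apply: eq_big_nat => i.
    by move=> /andP[-> _]; rewrite mulr_natl.
  apply: cvg_sum0 => i; have [di|_] := ltnP d i; last exact: cvg_cst.
  rewrite -[X in _ --> X](mulr0 ('C(j, i)%:R : R)); apply: cvgMl_tmp.
  exact: (iter_fdiff_power_orbit_cvg0 alpha_in r_gt0).
move/cvgr0Pnorm_le: err0 => /(_ _ e0); apply: filterS => n.
rewrite ger0_norm ?sumr_ge0 // => h j jk; apply: le_trans h.
by rewrite (bigD1 (Ordinal jk)) //= lerDl sumr_ge0.
Qed.

Lemma has_mean_bump (Q : nat) (W : {set {ffun 'I_d.+1 -> 'I_Q}}) : (0 < Q)%N ->
  has_mean (fun n => \sum_(w in W) bump (orbit n) w) (#|W|%:R / Q%:R ^+ d.+1).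
Proof.
move=> Q0; rewrite mulr_natl -sumr_const; apply: has_mean_sum => w _.
have := kernel_mean alpha_in r_gt0 Q0 (fun l => (w (inord l))%:R / Q%:R).
congr (has_mean _ _); apply/funext => n; apply: eq_bigr => l _.
by rewrite inord_val.
Qed.

Let volume : R := fine (lebesgue_tuple d.+1 (poly_region R k d)).
Local Notation K0 := (rounding_bound d k).

Let volumeE : lebesgue_tuple d.+1 (poly_region R k d) = volume%:E.
Proof.
rewrite fineK // ge0_fin_numE //.
exact: le_lt_trans (volume_le_lattice d_lt_k (ltn0Sn 0)) (ltry _).
Qed.

Let card_lattice_le T : (0 < T)%N ->
  #|lattice_points k d T|%:R <= (T + K0)%:R ^+ d.+1 * volume.
Proof.
move=> T0; have Q0 : (0 < T + K0)%N by rewrite addn_gt0 T0.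
have := @volume_ge_lattice R k d _ d_lt_k Q0 (leq_addl T K0).
by rewrite volumeE lee_fin addnK ler_pdivrMr ?exprn_gt0 ?ltr0n // mulrC.
Qed.

Let card_lattice_ge T : (K0 < T)%N ->
  (T - K0)%:R ^+ d.+1 * volume <= #|lattice_points k d T|%:R.
Proof.
move=> T0; have Q0 : (0 < T - K0)%N by rewrite subn_gt0.
have := @volume_le_lattice R k d _ d_lt_k Q0.
by rewrite volumeE lee_fin subnK ?(ltnW T0) // ler_pdivlMr ?exprn_gt0 ?ltr0n // mulrC.
Qed.

Let volume_ge0 : 0 <= volume.
Proof. by rewrite -lee_fin -volumeE. Qed.

Let hit (n : nat) : bool := `[< floors_extrapolate k d (orbit n) >].

(** The relative deviation from [Q = D * s] of the lengths of the ranges of values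
    that occur in the bounds of the density, after the comparison with the volume. *)
Let approx_error (D s : nat) : R := 2 / D%:R + K0%:R / (D * s)%:R.

(** With [Q = D * s] cells per coordinate and margin [K = s], the tolerance [eta]
    on the torus is of order [1 / D], independently of [s]: the contribution of
    the far cells is then [O(1 / s)]. *)
Lemma mean_hit_bounds D : (3 <= D)%N -> exists2 c : R, 0 < c &
  forall s e, (K0 < s)%N -> 0 < e -> \forall N \near \oo,
    (1 - approx_error D s) ^+ d.+1 * volume - c / s%:R - e <=
      arithmetic_mean (fun n => (hit n)%:R) N <=
    (1 + approx_error D s) ^+ d.+1 * volume + c / s%:R + e.
Proof.
move=> D3; pose B := extrapolation_bound d.+1 k.
have D0 : (0 < D)%N by exact: leq_trans D3.
have Dp : 0 < D%:R :> R by rewrite ltr0n.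
have Bp : 0 < B.+1%:R :> R by [].
(* With this tolerance the margin in [K_large] below is exactly [s]. *)
pose eta : R := (D%:R * B.+1%:R)^-1.
have eta0 : 0 < eta by rewrite invr_gt0 mulr_gt0.
have eta2 : 0 <= eta <= 1 / 2.
  rewrite (ltW eta0) /= mul1r lef_pV2 ?posrE ?mulr_gt0 //.
  by rewrite -natrM ler_nat (leq_trans (ltnW D3)) // leq_pmulr.
pose kappa : R := 1 - cos (2 * pi * eta).
have kappa0 : 0 < kappa.
  rewrite subr_gt0 -[ltRHS]cos0 ltr_cos ?in_itv /= ?lexx ?pi_ge0 //.
    by rewrite !mulr_gt0 ?pi_gt0.
  case/andP: eta2 => h1 h2; rewrite !mulr_ge0 ?pi_ge0 //=.
  by rewrite (le_trans (ler_wpM2l _ h2)) ?mulr_ge0 ?pi_ge0 //; have := pi_ge0 R; lra.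
exists (2 * d.+1%:R / (kappa * D%:R)).
  by rewrite divr_gt0 ?mulr_gt0.
move=> s e K0s e0; have s0 : (0 < s)%N by apply: leq_ltn_trans K0s.
have sp : 0 < s%:R :> R by rewrite ltr0n.
set Q := (D * s)%N.
have [Q0 Q2s K0Q _] : [/\ (0 < Q)%N, (s.*2 <= Q)%N, (K0 < Q - s.*2)%N & (2 <= D)%N].
  exact: cell_bounds.
have Qp : 0 < Q%:R :> R by rewrite ltr0n.
have QE : Q%:R = D%:R * s%:R :> R by rewrite natrM.
pose W1 := upper_cells k d Q s; pose W2 := lower_cells k d Q s.
pose tau : R := 2 * d.+1%:R / (kappa * Q%:R).
have tauE : 2 * d.+1%:R / (kappa * D%:R) / s%:R = tau.
  by rewrite /tau QE; field; rewrite !gt_eqF.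
have K_large : Q%:R * (eta *+ extrapolation_bound d.+1 k + eta) <= s%:R.
  rewrite -mulrSr -[eta *+ _]mulr_natr /eta QE le_eqVlt; apply/orP; left; apply/eqP.
  by field; rewrite !gt_eqF.
have tau0 : 0 <= tau by rewrite ltW // divr_gt0 ?mulr_gt0.
have near_eps := extrapolate_power_orbit_near eta0.
have up : \forall n \near \oo,
    (hit n)%:R <= \sum_(w in W1) bump (orbit n) w + tau.
  apply: filterS near_eps => n n_eps.
  have [/asboolP fl|_] := boolP (hit n); last first.
    by apply: addr_ge0 tau0; apply: sumr_ge0 => w _; exact: bump_ge0.
  have -> : true%:R = \sum_w @bump R d Q (orbit n) w by rewrite sum_bump.
  rewrite (bigID (far (orbit n) kappa)) /= addrC.
  apply: lerD; last exact: sum_bump_far.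
  rewrite big_mkcond [leRHS]big_mkcond; apply: ler_sum => w _.
  case: ifPn => [nfar|_]; last by case: ifP => // _; exact: bump_ge0.
  by rewrite (upper_cell_of_floors Q0 d_lt_k eta2 n_eps K_large fl nfar).
have low : \forall n \near \oo,
    \sum_(w in W2) bump (orbit n) w - tau <= (hit n)%:R.
  apply: filterS near_eps => n n_eps; rewrite lerBlDr.
  have [_|/asboolPn nfl] := boolP (hit n).
    have -> : true%:R = \sum_w @bump R d Q (orbit n) w by rewrite sum_bump.
    rewrite -[leLHS]addr0; apply: lerD => //.
    rewrite big_mkcond; apply: ler_sum => w _.
    by case: ifP => // _; exact: bump_ge0.
  rewrite add0r; apply: le_trans (@sum_bump_far R d Q Q0 (orbit n) kappa kappa0).
  rewrite big_mkcond [leRHS]big_mkcond; apply: ler_sum => w _.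
  case: ifPn => [wW|_]; last by case: ifP => // _; exact: bump_ge0.
  case: ifPn => // nfar; case: nfl.
  exact: (floors_of_lower_cell Q0 d_lt_k eta2 n_eps K_large wW nfar).
have mean1 := has_meanD (has_mean_bump (W := W1) Q0) (has_mean_cst (c := tau)).
have mean2 := has_meanD (has_mean_bump (W := W2) Q0) (has_mean_cst (c := - tau)).
have Qd0 : 0 < Q%:R ^+ d.+1 :> R by rewrite exprn_gt0.
have card1 : #|W1|%:R / Q%:R ^+ d.+1 <= (1 + approx_error D s) ^+ d.+1 * volume.
  have -> : 1 + approx_error D s = (Q + s.*2 + K0)%:R / Q%:R.
    by rewrite /approx_error -/Q !natrD -muln2 natrM QE; field; rewrite !gt_eqF.
  rewrite expr_div_n mulrAC ler_pM2r ?invr_gt0 //.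
  apply: le_trans (card_lattice_le _); last by rewrite addn_gt0 Q0.
  by rewrite ler_nat; exact: card_upper_cells.
have card2 : (1 - approx_error D s) ^+ d.+1 * volume <= #|W2|%:R / Q%:R ^+ d.+1.
  have -> : 1 - approx_error D s = (Q - s.*2 - K0)%:R / Q%:R.
    rewrite /approx_error -/Q (natrB _ (ltnW K0Q)) (natrB _ Q2s).
    by rewrite -muln2 natrM QE; field; rewrite !gt_eqF.
  rewrite expr_div_n mulrAC ler_pM2r ?invr_gt0 //.
  apply: (le_trans (card_lattice_ge K0Q)).
  by rewrite ler_nat; exact: card_lower_cells.
rewrite tauE; near=> N; apply/andP; split.
  rewrite lerBlDr; apply: (@le_trans _ _ (#|W2|%:R / Q%:R ^+ d.+1 - tau)).
    by rewrite lerD2r.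
  by rewrite -lerBlDr; near: N; exact: has_mean_near_ge low mean2 e0.
apply: (@le_trans _ _ (#|W1|%:R / Q%:R ^+ d.+1 + tau + e)).
  by near: N; exact: has_mean_near_le up mean1 e0.
by rewrite !lerD2r.
Unshelve. all: by end_near. Qed.

Lemma archimedean_nat (x : R) : exists n : nat, x < n%:R.
Proof. by exists (Num.truncn x).+1; exact: truncnS_gt. Qed.

(** Choose [D] first, so that [2 / D] is small, and then [s]; the bounds are
    continuous in [approx_error] at [0]. *)
Lemma has_mean_hit : has_mean (fun n => (hit n)%:R) volume.
Proof.
apply/cvgrPdist_le => e e0.
have v1 : 0 < volume + 1 by rewrite ltr_wpDl.
have e1 : 0 < e / 4 / (volume + 1) by rewrite !divr_gt0.
have [delta delta0 pow_near] : exists2 delta : R, 0 < delta &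
    forall x, `|x| < delta -> `|(1 + x) ^+ d.+1 * volume - volume| <= e / 4.
  have /cvgrPdist_le/(_ _ e1) := @exprn_continuous R d.+1 1.
  move=> [delta delta0 h]; exists delta => // x xd.
  have {}h : `|1 - (1 + x) ^+ d.+1| <= e / 4 / (volume + 1).
    have := h (1 + x); rewrite /= expr1n; apply.
    by rewrite opprD addrA subrr sub0r normrN.
  rewrite distrC -{1}[volume]mul1r -mulrBl normrM (ger0_norm volume_ge0).
  apply: le_trans (ler_wpM2r volume_ge0 h) _.
  by rewrite mulrAC ler_pdivrMr // ler_wpM2l ?divr_ge0 ?(ltW e0) // lerDl.
have [D0 D0E] := archimedean_nat (4 / delta).
(* At least [3], so that [D * s - 2 * s] exceeds the rounding bound as soon as
   [s] does. *)
pose D := (D0 + 3)%N.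
have Dp : 0 < D%:R :> R by rewrite ltr0n /D addn3.
have D3 : (3 <= D)%N by rewrite /D addn3.
have [c c0 bounds] := mean_hit_bounds D3.
have [s0 s0E] := archimedean_nat (2 * K0%:R / delta + 4 * c / e).
pose s := (s0 + K0.+1)%N.
have sp : 0 < s%:R :> R by rewrite ltr0n /s addnS.
have K0s : (K0 < s)%N by rewrite /s leq_addl.
have s0s : 2 * K0%:R / delta + 4 * c / e < s%:R.
  by apply: lt_le_trans s0E _; rewrite ler_nat leq_addr.
have t1 : 0 <= 2 * K0%:R / delta by rewrite divr_ge0 ?mulr_ge0 ?(ltW delta0).
have t2 : 0 <= 4 * c / e by rewrite divr_ge0 ?mulr_ge0 ?(ltW c0) ?(ltW e0).
have cs : c / s%:R <= e / 4.
  have : 4 * c / e < s%:R by lra.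
  by rewrite ltr_pdivrMr // ler_pdivrMr // => h; lra.
have err_small : `|approx_error D s| < delta.
  rewrite ger0_norm ?addr_ge0 ?divr_ge0 // /approx_error.
  have h1 : 2 / D%:R < delta / 2.
    have : 4 / delta < D%:R by apply: lt_le_trans D0E _; rewrite ler_nat leq_addr.
    by rewrite ltr_pdivrMr // ltr_pdivrMr // => h; lra.
  have h2 : K0%:R / (D * s)%:R <= delta / 2.
    apply: (@le_trans _ _ (K0%:R / s%:R)).
      rewrite ler_wpM2l // natrM lef_pV2 ?posrE ?mulr_gt0 //.
      by rewrite ler_peMl ?(ltW sp) // ler1n /D addn3.
    have : 2 * K0%:R / delta < s%:R by lra.
    by rewrite ltr_pdivrMr // ler_pdivrMr // => h; lra.
  by lra.
have e4 : 0 < e / 4 by rewrite divr_gt0.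
have up := pow_near _ err_small.
have low : `|(1 - approx_error D s) ^+ d.+1 * volume - volume| <= e / 4.
  by apply: pow_near; rewrite normrN.
apply: filterS (bounds s (e / 4) K0s e4) => N /andP[b1 b2].
move: up low; rewrite !ler_norml => /andP[u1 u2] /andP[l1 l2].
by apply/andP; split; lra.
Qed.
End density.

Theorem theorem1p1 (R : realType) (d : nat) (d_gt0 : (1 <= d)%N) :
  (forall (alpha : R) (k r : nat),
     d%:R < alpha < d.+1%:R -> (d + 2 <= k)%N -> (1 <= r)%N ->
     (fun N : nat =>
        ((count (fun n : nat =>
             [tuple Num.floor ((n + r * j)%N%:R `^ alpha) | j < k]
               \in poly_seqs k d)
           (index_iota 1 N.+1))%:R / N%:R)%:E)
       @ \oo --> lebesgue_tuple d.+1 (poly_region R k d))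
  /\
  (forall k : nat, (d + 2 <= k)%N ->
     (((\prod_(1 <= i < d.+1) 'C(k - 1, i)%:R)^-1)%:E
        <= lebesgue_tuple d.+1 (poly_region R k d))%E).
Proof.
split=> [alpha k r alpha_in dk r_gt0|k dk]; last first.
  by apply: volume_lower_bound; rewrite (leq_trans _ dk) // addn2.
have d_lt_k : (d < k)%N by rewrite (leq_trans _ dk) // addn2.
have mu_fin : lebesgue_tuple d.+1 (poly_region R k d) \is a fin_num.
  rewrite ge0_fin_numE //.
  exact: le_lt_trans (volume_le_lattice d_lt_k (ltn0Sn 0)) (ltry _).
pose p n := [tuple Num.floor ((n + r * j)%N%:R `^ alpha) | j < k] \in poly_seqs k d.
have pE n : p n.+1 = `[< floors_extrapolate k d (power_orbit alpha r n) >].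
  have floorP := floor_power_orbit_poly d_gt0 alpha_in dk r_gt0 n.
  by apply/idP/asboolP => [|/floorP h]; rewrite /p inE // => /floorP.
rewrite -(fineK mu_fin); apply: cvg_EFin; first exact: nearW.
rewrite -cvg_shiftS (_ : [sequence _]_n = arithmetic_mean
    (fun n => `[< floors_extrapolate k d (power_orbit alpha r n) >]%:R : R)).
  exact: has_mean_hit.
apply/funext => N; rewrite arithmetic_meanE [RHS]mulrC.
rewrite -[LHS]/((count p (index_iota 1 N.+2))%:R / N.+1%:R); congr (_ / _).
rewrite -sum1_count big_mkcond natr_sum big_add1 big_mkord.
by apply: eq_bigr => n _; rewrite pE; case: `[< _ >].
Qed.
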